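(* Fix $\mu\in\mathbb{R}^{m+q}$, $s\in\mathcal{S}$, $\rho>0$, and $z^{(0)}\in\mathcal{Z}$. Let $(z^{(l)})_{l\ge0}$ be generated by infinitely many successive primal sweeps on $L_\rho(\cdot,\mu,s)$. Then $(z^{(l)})$ converges to a point $z^\infty\in\mathcal{Z}$ which is a critical point of $L_\rho(\cdot,\mu,s)+\iota_{\mathcal{Z}}$, i.e. $0\in\nabla_zL_\rho(z^\infty,\mu,s)+\mathcal{N}_{\mathcal{Z}}(z^\infty)$.
   Context: Setting: $P\ge1$, $z=(z_1,\dots,z_P)\in\mathbb{R}^{n_z}$, $z_i\in\mathbb{R}^{n_i}$, $n_z\ge2$; each $\mathcal{Z}_i\subset\mathbb{R}^{n_i}$ a nonempty bounded box, $\mathcal{Z}=\mathcal{Z}_1\times\cdots\times\mathcal{Z}_P$; $J(z)=\sum_iJ_i(z_i)$ with polynomials $J_i$ of degree $\ge2$; polynomial maps $Q_c:\mathbb{R}^{n_z}\to\mathbb{R}^m$, $g_i:\mathbb{R}^{n_i}\to\mathbb{R}^{q_i}$; matrices $T_i\in\mathbb{R}^{q_i\times p}$; $q=\sum q_i$; $\mathcal{S}\subseteq\mathbb{R}^p$; $G(z,s)=(Q_c(z),g_1(z_1)+T_1s,\dots,g_P(z_P)+T_Ps)$. Augmented Lagrangian: $L_\rho(z,\mu,s)=J(z)+\big(\mu+\tfrac{\rho}{2}G(z,s)\big)^\top G(z,s)$. $\iota_{\mathcal{Z}}$ is the indicator of $\mathcal{Z}$; $\mathcal{N}_{\mathcal{Z}}$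 its normal cone; $\pi_{\mathcal{Z}_i}$ the Euclidean projection onto $\mathcal{Z}_i$. Primal sweep on $f=L_\rho(\cdot,\mu,s)$: fix $\alpha_i>0$, $\beta>1$ and $c_i^0>0$. Given $z^{(l)}\in\mathcal{Z}$, for $i=1,\dots,P$ in order, let $f^{(i,l)}(x):=f(z_1^{(l+1)},\dots,z_{i-1}^{(l+1)},x,z_{i+1}^{(l)},\dots,z_P^{(l)})$, set $c_i:=c_i^0$ and repeat: compute $u:=\pi_{\mathcal{Z}_i}\big(z_i^{(l)}-\tfrac1{c_i}\nabla f^{(i,l)}(z_i^{(l)})\big)$; if $f^{(i,l)}(u)+\tfrac{\alpha_i}{2}\|u-z_i^{(l)}\|^2\le f^{(i,l)}(z_i^{(l)})+\nabla f^{(i,l)}(z_i^{(l)})^\top(u-z_i^{(l)})+\tfrac{c_i}{2}\|u-z_i^{(l)}\|^2$ stop and set $z_i^{(l+1)}:=u$, otherwise set $c_i:=\beta c_i$ and repeat. The sweep outputs $z^{(l+1)}$. *)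

(* Defs.v *)
From Stdlib Require Import Reals Arith.
Open Scope R_scope.

Fixpoint rsum (n : nat) (F : nat -> R) : R :=
  match n with O => 0 | S n' => rsum n' F + F n' end.

Inductive mpoly : Type :=
| PC (c : R) | PX (k : nat) | PAdd (a b : mpoly) | PMul (a b : mpoly).

Fixpoint peval (x : nat -> R) (p : mpoly) : R :=
  match p with
  | PC c => c | PX k => x k
  | PAdd a b => peval x a + peval x b
  | PMul a b => peval x a * peval x b
  end.

Fixpoint pderiv (k : nat) (p : mpoly) : mpoly :=
  match p with
  | PC _ => PC 0
  | PX j => if Nat.eqb j k then PC 1 else PC 0
  | PAdd a b => PAdd (pderiv k a) (pderiv k b)
  | PMul a b => PAdd (PMul (pderiv k a) b) (PMul a (pderiv k b))
  end.

Fixpoint psdeg (p : mpoly) : nat :=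
  match p with
  | PC _ => 0 | PX _ => 1
  | PAdd a b => Nat.max (psdeg a) (psdeg b)
  | PMul a b => psdeg a + psdeg b
  end%nat.

Fixpoint pvars_in (A : nat -> Prop) (p : mpoly) : Prop :=
  match p with
  | PC _ => True | PX k => A k
  | PAdd a b | PMul a b => pvars_in A a /\ pvars_in A b
  end.

Fixpoint psum (n : nat) (F : nat -> mpoly) : mpoly :=
  match n with O => PC 0 | S n' => PAdd (psum n' F) (F n') end.

Definition poly_deg_le (p : mpoly) (d : nat) : Prop :=
  exists r, (forall x, peval x r = peval x p) /\ (psdeg r <= d)%nat.

(* ---- problem data ----
   Coordinates of z are 0..nz-1; coordinate k belongs to block blk k (< P).
   J i : polynomial in the block-i variables; Qc k (k < m) components of Q_c;
   g i j (j < q i) components of g_i; T i j r entries of T_i (r < p);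
   mu = (muc, mug) with muc k (k<m) and mug i j (i<P, j<q i). *)

Definition Gg (p : nat) (g : nat -> nat -> mpoly) (T : nat -> nat -> nat -> R)
  (s : nat -> R) (i j : nat) : mpoly :=
  PAdd (g i j) (PC (rsum p (fun r => T i j r * s r))).

Definition L_poly (P : nat) (J : nat -> mpoly) (m : nat) (Qc : nat -> mpoly)
  (q : nat -> nat) (g : nat -> nat -> mpoly) (p : nat)
  (T : nat -> nat -> nat -> R) (s : nat -> R)
  (muc : nat -> R) (mug : nat -> nat -> R) (rho : R) : mpoly :=
  PAdd (PAdd (psum P J)
             (psum m (fun k => PMul (PAdd (PC (muc k)) (PMul (PC (rho / 2)) (Qc k))) (Qc k))))
       (psum P (fun i => psum (q i) (fun j =>
          PMul (PAdd (PC (mug i j)) (PMul (PC (rho / 2)) (Gg p g T s i j))) (Gg p g T s i j)))).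

Definition grad (f : mpoly) (x : nat -> R) (k : nat) : R := peval x (pderiv k f).

Definition bsum (nz : nat) (blk : nat -> nat) (i : nat) (F : nat -> R) : R :=
  rsum nz (fun k => if Nat.eqb (blk k) i then F k else 0).

Definition inZ (nz : nat) (lo hi : nat -> R) (z : nat -> R) : Prop :=
  forall k, (k < nz)%nat -> lo k <= z k <= hi k.

Definition in_box_blk (nz : nat) (blk : nat -> nat) (lo hi : nat -> R) (i : nat)
  (u : nat -> R) : Prop :=
  forall k, (k < nz)%nat -> blk k = i -> lo k <= u k <= hi k.

Definition is_proj_blk (nz : nat) (blk : nat -> nat) (lo hi : nat -> R) (i : nat)
  (x u : nat -> R) : Prop :=
  in_box_blk nz blk lo hi i u /\
  forall y, in_box_blk nz blk lo hi i y ->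
    bsum nz blk i (fun k => (x k - u k) ^ 2) <= bsum nz blk i (fun k => (x k - y k) ^ 2).

Definition repl (blk : nat -> nat) (i : nat) (w u : nat -> R) (k : nat) : R :=
  if Nat.eqb (blk k) i then u k else w k.

Definition mix (blk : nat -> nat) (i : nat) (z z' : nat -> R) (k : nat) : R :=
  if Nat.ltb (blk k) i then z' k else z k.

Definition gstep (f : mpoly) (w : nat -> R) (c : R) (k : nat) : R :=
  w k - / c * grad f w k.

Definition accept (nz : nat) (blk : nat -> nat) (f : mpoly) (alpha : R) (i : nat)
  (w : nat -> R) (c : R) (u : nat -> R) : Prop :=
  peval (repl blk i w u) f + alpha / 2 * bsum nz blk i (fun k => (u k - w k) ^ 2)
  <= peval w f + bsum nz blk i (fun k => grad f w k * (u k - w k))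
     + c / 2 * bsum nz blk i (fun k => (u k - w k) ^ 2).

Definition block_update (nz : nat) (blk : nat -> nat) (lo hi : nat -> R) (f : mpoly)
  (alpha beta c0 : R) (i : nat) (w u : nat -> R) : Prop :=
  exists t : nat,
    (forall t', (t' < t)%nat -> forall u',
        is_proj_blk nz blk lo hi i (gstep f w (c0 * beta ^ t')) u' ->
        ~ accept nz blk f alpha i w (c0 * beta ^ t') u') /\
    is_proj_blk nz blk lo hi i (gstep f w (c0 * beta ^ t)) u /\
    accept nz blk f alpha i w (c0 * beta ^ t) u.

Definition sweep (nz P : nat) (blk : nat -> nat) (lo hi : nat -> R) (f : mpoly)
  (alpha : nat -> R) (beta : R) (c0 : nat -> R) (z z' : nat -> R) : Prop :=
  forall i, (i < P)%nat -> exists u,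
    block_update nz blk lo hi f (alpha i) beta (c0 i) i (mix blk i z z') u /\
    forall k, (k < nz)%nat -> blk k = i -> z' k = u k.

Definition in_normal_cone (nz : nat) (lo hi : nat -> R) (z v : nat -> R) : Prop :=
  forall y, inZ nz lo hi y -> rsum nz (fun k => v k * (y k - z k)) <= 0.

(* Main.v *)
(** The augmented Lagrangian is a polynomial, so the sequence converges by the
    Kurdyka-Lojasiewicz argument on the box. Quantifier elimination over the real
    closed field R makes every definable property of one real variable eventually
    true or eventually false on either side of a point. Hence a definable function
    of one variable is monotone and continuous on the right of every point. Apply
    this to the lexicographically smallest pair (residual r(t), point x(t)) on the
    level set f = t of the box, t -> f* from above, where the residual is the size
    of the projected gradient: x(t) is a curve with monotone coordinates, so it has
    a finite length function ell(t), and Taylor's formula along the curve gives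
    t - t' <= r(t) (ell t - ell t').
    One sweep decreases f by at least a |z' - z|^2, and the residual at z' is at
    most B |z' - z| since backtracking keeps the c_i bounded. With f* = lim f(z_l)
    this gives |z_(l+2) - z_(l+1)|^2 <= C |z_(l+1) - z_l| (ell(f(z_(l+1))) -
    ell(f(z_(l+2)))), so by AM-GM the steps are summable. *)

(* Elimination is applied only to formulas with one free real variable; the points of the box are
   quantified inside the formula, so the only geometric input is the germ of a definable set of
   reals. Minimising the residual first makes r(t) a lower bound for the residual of every point of
   the box at level t, not only of points near a limit. The inequality proved on the curve therefore
   holds at all iterates of low enough level. The remaining coordinates break ties, so that x(t) is
   a function with definable graph. The residual r is itself monotone in t. If it is nondecreasing,
   Taylor's inequality integrates with the constant r(t). If it is nonincreasing, it stays away from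
   0 near f*, and a linear function of t replaces the length. The desingularising function need not
   be a power: summability only uses that it is monotone and bounded below. The curve is never
   differentiated; one-sided local inequalities are integrated by a supremum argument. *)
Require Import Defs.
From Stdlib Require Import Reals Arith Lra Lia.
From Stdlib Require Import Classical ClassicalEpsilon FunctionalExtensionality.
From mathcomp Require all_boot order all_algebra polyrcf qe_rcf Rstruct.
Open Scope R_scope.

(** * Quantifier elimination and germs *)

Definition scons (v : R) (e : nat -> R) (i : nat) : R :=
  match i with O => v | S j => e j end.

Inductive fo : Type :=
| FPos (p : mpoly) | FNot (a : fo) | FAnd (a b : fo) | FEx (a : fo).

Fixpoint fsat (e : nat -> R) (a : fo) : Prop :=
  match a with
  | FPos p => 0 < peval e p
  | FNot b => ~ fsat e b
  | FAnd b c => fsat e b /\ fsat e c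
  | FEx b => exists v, fsat (scons v e) b
  end.

Module Elimination.
Import ssreflect ssrfun ssrbool eqtype ssrnat seq bigop order ssralg ssrnum.
Import poly polydiv interval polyrcf ordered_qelim qe_rcf Rstruct.
Import Order.TTheory GRing.Theory Num.Theory ord.
Local Open Scope ring_scope.

Fixpoint tr_poly (d : nat) (p : mpoly) : GRing.term R :=
  match p with
  | PC c => GRing.Const c
  | PX i => if (i <= d)%N then GRing.Var R (d - i) else GRing.Const (0 : R)
  | PAdd a b => GRing.Add (tr_poly d a) (tr_poly d b)
  | PMul a b => GRing.Mul (tr_poly d a) (tr_poly d b)
  end.

(* At quantifier depth d the de Bruijn index i is the named variable d - i, so
   that the only free variable of a translated formula is the variable 0. *)
Fixpoint tr (d : nat) (a : fo) : ord.formula R :=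
  match a with
  | FPos p => ord.Lt (GRing.NatConst R 0) (tr_poly d p)
  | FNot b => ord.Not (tr d b)
  | FAnd b c => ord.And (tr d b) (tr d c)
  | FEx b => ord.Exists d.+1 (tr d.+1 b)
  end.

(** An index beyond the depth reads 0, as in [tr_poly] and in the environment [fun=> 0] of
    [fo_germ]. *)
Definition env (d : nat) (l : seq R) (i : nat) : R :=
  if (i <= d)%N then nth 0 l (d - i) else 0.

Lemma tr_polyP d l p : peval (env d l) p = GRing.eval l (tr_poly d p).
Proof.
elim: p => //= [k|a -> b ->|a -> b ->] //.
by rewrite /env; case: ifP.
Qed.

Lemma env_set d l v : scons v (env d l) = env d.+1 (set_nth 0 l d.+1 v).
Proof.
apply: functional_extensionality => -[|i]; rewrite /scons /env.
  by rewrite subn0 nth_set_nth /= eqxx.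
rewrite ltnS subSS; case: ifP => // hi; rewrite nth_set_nth /=.
by rewrite ltn_eqF // ltnS leq_subr.
Qed.

Lemma trP a d l : fsat (env d l) a <-> holds l (tr d a).
Proof.
elim: a d l => /= [p|b ih|b ihb c ihc|b ih] d l.
- by rewrite tr_polyP; split => /RltP.
- by rewrite ih.
- by rewrite ihb ihc.
- by split=> -[v hv]; exists v; move: hv; rewrite env_set ih.
Qed.

(** Along a polynomial path in the variable 0, a term without inverses is a polynomial in the
    parameter; every other variable falls on the default 0 of the environment. *)
Lemma term_poly (q : {poly R}) (t : GRing.term R) : GRing.rterm t ->
  exists p : {poly R}, forall h, GRing.eval [:: q.[h]] t = p.[h].
Proof.
elim: t => //=.
- move=> [|n] _; first by exists q.
  by exists 0 => h; rewrite hornerC; case: n.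
- by move=> c _; exists c%:P => h; rewrite hornerC.
- by move=> n _; exists (n%:R)%:P => h; rewrite hornerC.
- move=> t ht u hu /andP[/ht[p hp] /hu[r hr]].
  by exists (p + r) => h; rewrite hornerD hp hr.
- by move=> t ht /ht[p hp]; exists (- p) => h; rewrite hornerN hp.
- by move=> t ht n /ht[p hp]; exists (p *+ n) => h; rewrite hornerMn hp.
- move=> t ht u hu /andP[/ht[p hp] /hu[r hr]].
  by exists (p * r) => h; rewrite hornerM hp hr.
- by move=> t ht n /ht[p hp]; exists (p ^+ n) => h; rewrite horner_exp hp.
Qed.

(** A nonzero polynomial has no root strictly between 0 and [next_root p 0 1], so it keeps its sign
    there. *)
Lemma sgr_germ (p : {poly R}) :
  exists eps : R, 0 < eps /\ exists s : R, forall h, 0 < h < eps -> Num.sg p.[h] = s.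
Proof.
have [->|p0] := eqVneq p 0.
  by exists 1; split => //; exists 0 => h _; rewrite hornerC sgr0.
exists (next_root p 0 1); split; first exact: next_root_gt.
by exists (sgp_right p 0) => h hh; apply: (@sgr_neighpr R 1).
Qed.

Lemma qf_germ (q : {poly R}) f : qf_form f -> rformula f ->
  exists eps : R, 0 < eps /\ exists b : bool,
    forall h, 0 < h < eps -> qf_eval [:: q.[h]] f = b.
Proof.
have atom (t u : GRing.term R) : GRing.rterm t && GRing.rterm u ->
  exists eps : R, 0 < eps /\ exists s : R, forall h, 0 < h < eps ->
    Num.sg (GRing.eval [:: q.[h]] t - GRing.eval [:: q.[h]] u) = s.
  move=> /andP[/(term_poly q)[p hp] /(term_poly q)[r hr]].
  have [e [e0 [s hs]]] := sgr_germ (p - r).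
  by exists e; split => //; exists s => h /hs <-; rewrite hp hr hornerD hornerN.
have bin (op : bool -> bool -> bool) (A B : R -> bool) :
  (exists eps : R, 0 < eps /\ exists b : bool, forall h, 0 < h < eps -> A h = b) ->
  (exists eps : R, 0 < eps /\ exists b : bool, forall h, 0 < h < eps -> B h = b) ->
  (exists eps : R, 0 < eps /\ exists b : bool, forall h, 0 < h < eps -> op (A h) (B h) = b).
  move=> [e1 [e10 [b1 h1]]] [e2 [e20 [b2 h2]]].
  exists (Num.min e1 e2); split; first by rewrite lt_min e10.
  exists (op b1 b2) => h; rewrite lt_min => /and3P[h0 he1 he2].
  by rewrite h1 ?h2 ?h0.
elim: f => //=.
- by move=> b _ _; exists 1; split => //; exists b.
- move=> t u _ /atom[e [e0 [s hs]]]; exists e; split => //; exists (s == 0) => h /hs <-.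
  by rewrite sgr_eq0 subr_eq0.
- move=> t u _ /atom[e [e0 [s hs]]]; exists e; split => //; exists (s == -1) => h /hs <-.
  by rewrite sgr_cp0 subr_lt0.
- move=> t u _ /atom[e [e0 [s hs]]]; exists e; split => //; exists (s != 1) => h /hs <-.
  by rewrite sgr_cp0 subr_gt0 -leNgt.
- by move=> f hf g hg /andP[/hf{}hf /hg{}hg] /andP[/hf{}hf /hg{}hg]; apply: bin.
- by move=> f hf g hg /andP[/hf{}hf /hg{}hg] /andP[/hf{}hf /hg{}hg]; apply: bin.
- by move=> f hf g hg /andP[/hf{}hf /hg{}hg] /andP[/hf{}hf /hg{}hg]; apply: bin.
- move=> f hf qf rf; have [e [e0 [b hb]]] := hf qf rf.
  by exists e; split => //; exists (~~ b) => h /hb ->.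
Qed.

(** The affine path serves both sides of [x0], with [s] equal to 1 or -1, while the germ is always
    taken at 0 from the right. *)
Lemma fo_germ (a : fo) (x0 s : R) :
  exists eps : R, Rlt 0 eps /\
   ((forall h, Rlt 0 h -> Rlt h eps -> fsat (scons (Rplus x0 (Rmult s h)) (fun=> 0)) a) \/
    (forall h, Rlt 0 h -> Rlt h eps -> ~ fsat (scons (Rplus x0 (Rmult s h)) (fun=> 0)) a)).
Proof.
pose f := to_rform (tr 0 a); pose g := quantifier_elim (@wproj R) f.
have rf : rformula f := to_rform_rformula _.
have /andP[qg rg] := quantifier_elim_wf (@wf_QE_wproj R) rf.
have [e [e0 [b hb]]] := qf_germ (x0%:P + s *: 'X) g qg rg.
have E h : scons (Rplus x0 (Rmult s h)) (fun=> 0) = env 0 [:: (x0%:P + s *: 'X).[h]].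
  apply: functional_extensionality => -[|i] //=.
  by rewrite /env /= hornerD hornerC hornerZ hornerX.
exists e; split; first exact/RltP.
have key h : Rlt 0 h -> Rlt h e -> fsat (scons (Rplus x0 (Rmult s h)) (fun=> 0)) a <-> b.
  move=> /RltP h0 /RltP he; rewrite -(hb h) ?h0 // E trP.
  exact: (rwP (proj_satP (@wf_QE_wproj R) (@valid_QE_wproj R) _ _)).
by case: b {hb} key => key; [left|right] => h h0 he; rewrite key.
Qed.

End Elimination.

(** * Definable predicates *)

Fixpoint psubst (s : nat -> mpoly) (p : mpoly) : mpoly :=
  match p with
  | PC c => PC c
  | PX k => s k
  | PAdd a b => PAdd (psubst s a) (psubst s b)
  | PMul a b => PMul (psubst s a) (psubst s b)
  end.

Lemma peval_psubst e s p : peval e (psubst s p) = peval (fun i => peval e (s i)) p.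
Proof. induction p; simpl; congruence. Qed.

Definition lift (s : nat -> mpoly) (i : nat) : mpoly :=
  match i with O => PX 0 | S j => psubst (fun k => PX (S k)) (s j) end.

Fixpoint fsubst (s : nat -> mpoly) (a : fo) : fo :=
  match a with
  | FPos p => FPos (psubst s p)
  | FNot b => FNot (fsubst s b)
  | FAnd b c => FAnd (fsubst s b) (fsubst s c)
  | FEx b => FEx (fsubst (lift s) b)
  end.

Lemma fsat_fsubst a : forall e s,
  fsat e (fsubst s a) <-> fsat (fun i => peval e (s i)) a.
Proof.
  induction a as [p|b IH|b IHb c IHc|b IH]; intros e s; simpl.
  - rewrite peval_psubst; tauto.
  - rewrite IH; tauto.
  - rewrite IHb, IHc; tauto.
  - assert (H : forall v, (fun i => peval (scons v e) (lift s i))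
                          = scons v (fun i => peval e (s i))).
    { intros v; apply functional_extensionality; intros [|i]; simpl; auto.
      rewrite peval_psubst; reflexivity. }
    split; intros [v Hv]; exists v; [rewrite IH, H in Hv | rewrite IH, H]; exact Hv.
Qed.

(** Definability is with parameters, since [PC] carries any real. It is a property of predicates on
    environments, so that closure lemmas replace the writing of formulas. *)
Definition definable (A : (nat -> R) -> Prop) : Prop :=
  exists a, forall e, A e <-> fsat e a.

Definition polyfun (F : (nat -> R) -> R) : Prop :=
  exists p, forall e, F e = peval e p.

Lemma polyfun_var i : polyfun (fun e => e i).
Proof. exists (PX i); reflexivity. Qed.

Lemma polyfun_const c : polyfun (fun _ => c).
Proof. exists (PC c); reflexivity. Qed.

Lemma polyfun_add F G : polyfun F -> polyfun G -> polyfun (fun e => F e + G e).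
Proof. intros [p Hp] [q Hq]; exists (PAdd p q); intros e; simpl; congruence. Qed.

Lemma polyfun_mul F G : polyfun F -> polyfun G -> polyfun (fun e => F e * G e).
Proof. intros [p Hp] [q Hq]; exists (PMul p q); intros e; simpl; congruence. Qed.

Lemma polyfun_opp F : polyfun F -> polyfun (fun e => - F e).
Proof.
  intros [p Hp]; exists (PMul (PC (-1)) p); intros e; simpl; rewrite Hp; ring.
Qed.

Lemma polyfun_sub F G : polyfun F -> polyfun G -> polyfun (fun e => F e - G e).
Proof. intros HF HG; apply polyfun_add; [|apply polyfun_opp]; assumption. Qed.

Lemma polyfun_peval (r : nat -> nat) p : polyfun (fun e => peval (fun i => e (r i)) p).
Proof.
  exists (psubst (fun i => PX (r i)) p); intros e; rewrite peval_psubst; reflexivity.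
Qed.

Lemma definable_ext A B : (forall e, A e <-> B e) -> definable A -> definable B.
Proof. intros H [a Ha]; exists a; intros e; rewrite <- H; apply Ha. Qed.

Lemma definable_lt F G : polyfun F -> polyfun G -> definable (fun e => F e < G e).
Proof.
  intros HF HG; destruct (polyfun_sub G F HG HF) as [p Hp].
  exists (FPos p); intros e; simpl; rewrite <- Hp; lra.
Qed.

Lemma definable_not A : definable A -> definable (fun e => ~ A e).
Proof. intros [a Ha]; exists (FNot a); intros e; simpl; rewrite Ha; tauto. Qed.

Lemma definable_and A B : definable A -> definable B -> definable (fun e => A e /\ B e).
Proof.
  intros [a Ha] [b Hb]; exists (FAnd a b); intros e; simpl; rewrite Ha, Hb; tauto.
Qed.

Lemma definable_imp A B : definable A -> definable B -> definable (fun e => A e -> B e).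
Proof.
  intros HA HB; apply definable_ext with (fun e => ~ (A e /\ ~ B e)).
  - intros e; destruct (classic (B e)); tauto.
  - apply definable_not, definable_and; [|apply definable_not]; assumption.
Qed.

Lemma definable_le F G : polyfun F -> polyfun G -> definable (fun e => F e <= G e).
Proof.
  intros HF HG; apply definable_ext with (fun e => ~ (G e < F e)).
  - intros e; split; lra.
  - apply definable_not, definable_lt; assumption.
Qed.

Lemma definable_eq F G : polyfun F -> polyfun G -> definable (fun e => F e = G e).
Proof.
  intros HF HG; apply definable_ext with (fun e => F e <= G e /\ G e <= F e).
  - intros e; split; lra.
  - apply definable_and; apply definable_le; assumption.
Qed.

Lemma definable_ex (A : R -> (nat -> R) -> Prop) :
  definable (fun e => A (e 0%nat) (fun i => e (S i))) -> definable (fun e => exists v, A v e).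
Proof.
  intros [a Ha]; exists (FEx a); intros e; simpl.
  split; intros [v Hv]; exists v; apply (Ha (scons v e)); exact Hv.
Qed.

Lemma definable_all (A : R -> (nat -> R) -> Prop) :
  definable (fun e => A (e 0%nat) (fun i => e (S i))) -> definable (fun e => forall v, A v e).
Proof.
  intros HA; apply definable_ext with (fun e => ~ exists v, ~ A v e).
  - intros e; split; intros H.
    + intros v; apply NNPP; intros Hv; apply H; exists v; exact Hv.
    + intros [v Hv]; auto.
  - apply definable_not, (definable_ex (fun v e => ~ A v e)), definable_not, HA.
Qed.

Lemma definable_comp A (F : nat -> (nat -> R) -> R) :
  definable A -> (forall i, polyfun (F i)) -> definable (fun e => A (fun i => F i e)).
Proof.
  intros [a Ha] HF; destruct (choice _ HF) as [s Hs].
  exists (fsubst s a); intros e; rewrite fsat_fsubst, Ha.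
  replace (fun i => F i e) with (fun i => peval e (s i)); [tauto|].
  apply functional_extensionality; intros i; symmetry; apply Hs.
Qed.

(** A definable function enters formulas only through its graph [G], which must then be read at
    various polynomial arguments. *)
Lemma definable_rel (G : R -> R -> Prop) E F :
  definable (fun e => G (e 0%nat) (e 1%nat)) -> polyfun E -> polyfun F ->
  definable (fun e => G (E e) (F e)).
Proof.
  intros HG HE HF.
  apply (definable_comp _ (fun i => match i with O => E | _ => F end) HG).
  intros [|i]; assumption.
Qed.

Lemma definable_germ (A : R -> Prop) (a s : R) : definable (fun e => A (e 0%nat)) ->
  exists eps, 0 < eps /\
    ((forall k, 0 < k < eps -> A (a + s * k)) \/
     (forall k, 0 < k < eps -> ~ A (a + s * k))).
Proof.
  intros [f Hf]; destruct (Elimination.fo_germ f a s) as (eps & He & H).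
  exists eps; split; [exact He|].
  destruct H as [H|H]; [left|right]; intros k [Hk1 Hk2]; specialize (H k Hk1 Hk2).
  - apply Hf in H; exact H.
  - intros HA; apply H; rewrite <- Hf; exact HA.
Qed.

(** * Tactics for definability, and germs of relations between values *)

Ltac polyfunc :=
  cbv beta;
  match goal with
  | |- polyfun (fun e => ?F + ?G) => apply polyfun_add; polyfunc
  | |- polyfun (fun e => ?F - ?G) => apply polyfun_sub; polyfunc
  | |- polyfun (fun e => ?F * ?G) => apply polyfun_mul; polyfunc
  | |- polyfun (fun e => - ?F) => apply polyfun_opp; polyfunc
  | |- polyfun (fun e => e _) => apply polyfun_var
  | |- polyfun (fun e => ?c) => apply polyfun_const
  | |- polyfun (fun e => peval _ _) => apply polyfun_peval
  | |- _ => idtac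
  end.

Ltac definability :=
  cbv beta;
  match goal with
  | |- definable (fun e => exists v, _) => apply definable_ex; definability
  | |- definable (fun e => ?A /\ ?B) => apply definable_and; definability
  | |- definable (fun e => ~ ?A) => apply definable_not; definability
  | |- definable (fun e => _ < _) => apply definable_lt; polyfunc
  | |- definable (fun e => _ <= _) => apply definable_le; polyfunc
  | |- definable (fun e => _ = _) => apply definable_eq; polyfunc
  | |- definable (fun e => ?A -> ?B) => apply definable_imp; definability
  | |- definable (fun e => forall v : R, _) => apply definable_all; definability
  | |- _ => idtac
  end.

(** Two germs in succession: at each [t] the relation is settled for all small [k], and the way in
    which it is settled is a definable property of [t], hence the same for all [t] just to the right
    of [a]. *)
Lemma germ_dichotomy (G A : R -> R -> Prop) (h : R -> R) (a b s : R) :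
  definable (fun e => G (e 0%nat) (e 1%nat)) ->
  definable (fun e => A (e 0%nat) (e 1%nat)) ->
  s = 1 \/ s = -1 -> a < b -> (forall t, a < t < b -> forall y, G t y <-> y = h t) ->
  exists c, a < c <= b /\
   ((forall t, a < t < c -> exists d, 0 < d /\ forall k, 0 < k < d ->
        A (h t) (h (t + s * k))) \/
    (forall t, a < t < c -> exists d, 0 < d /\ forall k, 0 < k < d ->
        ~ A (h t) (h (t + s * k)))).
Proof.
  intros HG HA Hs Hab Hh.
  (* [C] mentions only the graph, which makes it definable; it agrees with the relation between
     values while both arguments lie in (a, b). *)
  set (C := fun t k => forall y y', G t y -> G (t + s * k) y' -> A y y').
  assert (HC : definable (fun e => C (e 0%nat) (e 1%nat))).
  { unfold C; definability; (apply definable_rel; [assumption|polyfunc..]). }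
  assert (Hnear : forall t, a < t < b -> exists d, 0 < d /\ forall k, 0 < k < d ->
             a < t + s * k < b).
  { intros t Ht; exists (Rmin (t - a) (b - t)); split; [apply Rmin_glb_lt; lra|].
    intros k [Hk1 Hk2]; pose proof (Rmin_l (t - a) (b - t)); pose proof (Rmin_r (t - a) (b - t)).
    destruct Hs as [-> | ->]; lra. }
  assert (HCA : forall t k, a < t < b -> a < t + s * k < b ->
             (C t k <-> A (h t) (h (t + s * k)))).
  { intros t k Ht Hk; unfold C; split; intros H.
    - apply H; apply Hh; auto.
    - intros y y' Hy Hy'; apply Hh in Hy, Hy'; subst; auto. }
  destruct (definable_germ
     (fun t => exists d, 0 < d /\ forall k, 0 < k < d -> C t k) a 1) as (eps & He & H).
  { definability; apply definable_rel; [assumption|polyfunc..]. }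
  exists (Rmin b (a + eps)); split.
  { split; [apply Rmin_glb_lt; lra | apply Rmin_l]. }
  assert (Hin : forall t, a < t < Rmin b (a + eps) -> a < t < b /\ 0 < t - a < eps).
  { intros t Ht; pose proof (Rmin_l b (a + eps)); pose proof (Rmin_r b (a + eps)); lra. }
  destruct H as [H|H]; [left|right]; intros t Ht; destruct (Hin t Ht) as [Htb Hte];
    specialize (H (t - a) Hte); replace (a + 1 * (t - a)) with t in H by ring;
    destruct (Hnear t Htb) as (d1 & Hd1 & Hn).
  - destruct H as (d & Hd & H).
    exists (Rmin d d1); split; [apply Rmin_glb_lt; lra|].
    intros k Hk; pose proof (Rmin_l d d1); pose proof (Rmin_r d d1).
    apply HCA; [lra|apply Hn; lra|apply H; lra].
  (* Here [C t] does not hold for all small [k]; the germ in [k] turns this into failure for all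
     small [k]. *)
  - destruct (definable_germ (fun k => C t k) 0 1) as (d & Hd & H').
    { apply (definable_rel C (fun _ => t) (fun e => e 0%nat)); [assumption|polyfunc..]. }
    destruct H' as [H'|H'].
    { destruct H; exists d; split; [lra|]; intros k Hk.
      specialize (H' k Hk); replace (0 + 1 * k) with k in H' by ring; exact H'. }
    exists (Rmin d d1); split; [apply Rmin_glb_lt; lra|].
    intros k Hk; pose proof (Rmin_l d d1); pose proof (Rmin_r d d1).
    assert (Hkd : 0 < k < d) by lra.
    specialize (H' k Hkd); replace (0 + 1 * k) with k in H' by ring.
    rewrite HCA in H'; [exact H'|lra|apply Hn; lra].
Qed.

(** * Monotonicity and continuity of definable functions *)

(** A supremum argument without continuity: let [m] be the supremum of the points up to which [g]
    stays above [g s]. The left condition gives [g s <= g m], and the right condition would carry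
    the bound past any [m < t]. *)
Lemma locally_nondecreasing (g : R -> R) (a b : R) :
  (forall t, a < t < b -> exists d, 0 < d /\ forall k, 0 < k < d -> g t <= g (t + 1 * k)) ->
  (forall t, a < t < b -> exists d, 0 < d /\ forall k, 0 < k < d -> g (t + -1 * k) <= g t) ->
  forall s t, a < s -> s <= t -> t < b -> g s <= g t.
Proof.
  intros HR HL s t Has Hst Htb.
  set (E := fun x => s <= x <= t /\ forall u, s <= u <= x -> g s <= g u).
  assert (Es : E s).
  { split; [lra|]; intros u Hu; replace u with s by lra; lra. }
  destruct (completeness E) as [m [Hub Hlub]].
  { exists t; intros x [Hx _]; lra. }
  { exists s; exact Es. }
  assert (Hm : s <= m <= t).
  { split; [apply Hub, Es | apply Hlub; intros x [Hx _]; lra]. }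
  assert (Hbelow : forall u, s <= u < m -> g s <= g u).
  { intros u Hu; apply NNPP; intros Hn.
    assert (m <= u); [|lra].
    apply Hlub; intros x [Hx Hxu]; apply Rnot_lt_le; intros Hux.
    apply Hn, Hxu; lra. }
  assert (Hgm : g s <= g m).
  { destruct (Req_dec s m) as [<-|Hne]; [lra|].
    destruct (HL m) as (d & Hd & H); [lra|].
    set (k := Rmin (d / 2) (m - s)).
    assert (Hk : 0 < k < d /\ k <= m - s).
    { unfold k; pose proof (Rmin_l (d / 2) (m - s)); pose proof (Rmin_r (d / 2) (m - s)).
      split; [split|]; try lra. apply Rmin_glb_lt; lra. }
    apply Rle_trans with (g (m + -1 * k)); [apply Hbelow; lra | apply H; lra]. }
  destruct (Rle_lt_or_eq_dec m t) as [Hmt|<-]; [lra| |exact Hgm].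
  destruct (HR m) as (d & Hd & H); [lra|].
  set (k := Rmin (d / 2) (t - m)).
  assert (Hk : 0 < k < d /\ k <= t - m).
  { unfold k; pose proof (Rmin_l (d / 2) (t - m)); pose proof (Rmin_r (d / 2) (t - m)).
    split; [split|]; try lra. apply Rmin_glb_lt; lra. }
  assert (E (m + k)); [|assert (m + k <= m) by (apply Hub; assumption); lra].
  split; [lra|]; intros u Hu.
  destruct (Rlt_le_dec u m); [apply Hbelow; lra|].
  destruct (Req_dec u m) as [->|]; [exact Hgm|].
  replace u with (m + 1 * (u - m)) by ring.
  apply Rle_trans with (g m); [exact Hgm|apply H; lra].
Qed.

(** Baire's theorem by nested closed intervals, each avoiding one more [A n]. Strict nesting keeps
    the limit point inside the open interval. *)
Lemma interval_baire (A : nat -> R -> Prop) (a b : R) : a < b ->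
  (forall n c d, a <= c -> c < d -> d <= b ->
     exists c' d', c < c' /\ c' < d' /\ d' < d /\ forall t, c' <= t <= d' -> ~ A n t) ->
  exists t, a < t < b /\ forall n, ~ A n t.
Proof.
  intros Hab H.
  set (I := {p : R * R | a <= fst p /\ fst p < snd p /\ snd p <= b}).
  assert (Hnext : forall n (p : I), exists q : I,
     fst (proj1_sig p) < fst (proj1_sig q) /\ snd (proj1_sig q) < snd (proj1_sig p) /\
     forall t, fst (proj1_sig q) <= t <= snd (proj1_sig q) -> ~ A n t).
  { intros n [[c d] (H1 & H2 & H3)]; simpl in *.
    destruct (H n c d) as (c' & d' & H4 & H5 & H6 & H7); [lra..|].
    assert (Hq : a <= c' /\ c' < d' /\ d' <= b) by lra.
    exists (exist _ (c', d') Hq); simpl; auto. }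
  destruct (choice (fun (x : nat * I) (q : I) =>
     fst (proj1_sig (snd x)) < fst (proj1_sig q) /\
     snd (proj1_sig q) < snd (proj1_sig (snd x)) /\
     forall t, fst (proj1_sig q) <= t <= snd (proj1_sig q) -> ~ A (fst x) t))
    as [next Hn].
  { intros [n p]; apply Hnext. }
  assert (H0 : a <= a /\ a < b /\ b <= b) by lra.
  set (s := fix s n : I := match n with
                         | O => exist _ (a, b) H0
                         | S n' => next (n', s n') end).
  set (l := fun n => fst (proj1_sig (s n))); set (r := fun n => snd (proj1_sig (s n))).
  assert (Hs : forall n, l n < l (S n) /\ r (S n) < r n /\
             forall t, l (S n) <= t <= r (S n) -> ~ A n t).
  { intros n; apply (Hn (n, s n)). }
  assert (Hlr : forall n, l n < r n) by (intros n; exact (proj1 (proj2 (proj2_sig (s n))))).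
  assert (Hmono : forall n m, (n <= m)%nat -> l n <= l m /\ r m <= r n).
  { intros n m Hnm; induction Hnm as [|m _ IH]; [lra|]; destruct (Hs m); lra. }
  assert (Hlr' : forall n m, l n < r m).
  { intros n m; destruct (Nat.le_ge_cases n m) as [h|h]; apply Hmono in h;
      [specialize (Hlr m)|specialize (Hlr n)]; lra. }
  destruct (completeness (fun x => exists n, x = l n)) as [t [Hub Hlub]].
  { exists b; intros x [n ->]; apply Rlt_le, (Hlr' n 0%nat). }
  { exists (l 0%nat), 0%nat; reflexivity. }
  assert (Ht : forall n, l n <= t <= r n).
  { intros n; split; [apply Hub; eauto|]; apply Hlub; intros x [m ->]; apply Rlt_le, Hlr'. }
  exists t; split.
  - destruct (Hs 0%nat) as (H1 & H2 & _); specialize (Ht 1%nat); simpl in *.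
    unfold l, r in *; simpl in *; lra.
  - intros n; apply (Hs n), Ht.
Qed.

Lemma inv_INR_lt (x : R) : 0 < x -> exists n : nat, / (INR n + 1) < x.
Proof.
  intros Hx; destruct (archimed_cor1 x Hx) as (n & H1 & H2); exists n.
  apply Rlt_trans with (/ INR n); [|exact H1].
  assert (0 < INR n) by (apply lt_0_INR; lia).
  apply Rinv_lt_contravar; [nra|lra].
Qed.

(** The points that are strict minima within radius 1/(n+1) are isolated: of two of them closer than
    that, each would have the smaller value. Such sets are nowhere dense, so they cannot cover an
    interval. *)
Lemma not_strict_min_everywhere (h : R -> R) (a b : R) : a < b ->
  (forall t, a < t < b -> exists d, 0 < d /\ forall k, 0 < k < d -> h t < h (t + 1 * k)) ->
  (forall t, a < t < b -> exists d, 0 < d /\ forall k, 0 < k < d -> h t < h (t + -1 * k)) ->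
  False.
Proof.
  intros Hab HR HL.
  set (A := fun (n : nat) t => forall u, u <> t -> Rabs (u - t) < / (INR n + 1) -> h t < h u).
  destruct (interval_baire A a b Hab) as (t & Ht & Hn).
  - intros n c d Hac Hcd Hdb.
    destruct (classic (exists t0, c < t0 < d /\ A n t0)) as [(t0 & Ht0 & H0)|Hno].
    + set (w := Rmin (d - t0) (/ (INR n + 1))).
      assert (Hw : 0 < w).
      { apply Rmin_glb_lt; [lra|]; apply Rinv_0_lt_compat; pose proof (pos_INR n); lra. }
      pose proof (Rmin_l (d - t0) (/ (INR n + 1))); pose proof (Rmin_r (d - t0) (/ (INR n + 1))).
      fold w in H, H1.
      exists (t0 + w / 3), (t0 + 2 * (w / 3)); repeat split; try lra.
      intros t Ht HA.
      assert (h t < h t0) by (apply HA; [lra|apply Rabs_def1; lra]).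
      assert (h t0 < h t) by (apply H0; [lra|apply Rabs_def1; lra]).
      lra.
    + exists (c + (d - c) / 3), (c + 2 * ((d - c) / 3)); repeat split; try lra.
      intros t Ht HA; apply Hno; exists t; split; [lra|exact HA].
  - destruct (HR t Ht) as (d1 & Hd1 & H1); destruct (HL t Ht) as (d2 & Hd2 & H2).
    destruct (inv_INR_lt (Rmin d1 d2)) as [n Hlt]; [apply Rmin_glb_lt; lra|].
    pose proof (Rmin_l d1 d2); pose proof (Rmin_r d1 d2).
    apply (Hn n); intros u Hu Hut; apply Rabs_def2 in Hut.
    destruct (Rlt_le_dec t u).
    + replace u with (t + 1 * (u - t)) by ring; apply H1; lra.
    + replace u with (t + -1 * (t - u)) by ring; apply H2; lra.
Qed.

(** Two inequalities take the place of [Rabs], so that the same clauses can be repeated on a graph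
    in definable form. *)
Definition continuous_at (h : R -> R) (t : R) : Prop :=
  forall eps, 0 < eps -> exists d, 0 < d /\
    forall u, - d < u - t -> u - t < d -> - eps < h u - h t /\ h u - h t < eps.

(** [A n] gathers the points where [h] jumps by at least 1/(n+1). If it met every subinterval, each
    subinterval would carry such an increase, and the increase between two fixed points would be
    infinite. *)
Lemma nondecreasing_continuity_point (h : R -> R) (a b : R) : a < b ->
  (forall s t, a < s -> s <= t -> t < b -> h s <= h t) ->
  exists t, a < t < b /\ continuous_at h t.
Proof.
  intros Hab Hmon.
  set (A := fun (n : nat) t => forall s s', a < s -> s < t -> t < s' -> s' < b ->
              / (INR n + 1) <= h s' - h s).
  set (w := (b - a) / 3).
  destruct (interval_baire A (a + w) (b - w)) as (t & Ht & Hn).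
  - unfold w; lra.
  - intros n c d Hc Hcd Hd; apply NNPP; intros Hno.
    assert (Hpos : 0 < / (INR n + 1)).
    { apply Rinv_0_lt_compat; pose proof (pos_INR n); lra. }
    assert (HA : forall x y, c < x -> x < y -> y < d -> / (INR n + 1) <= h y - h x).
    { intros x y Hx Hxy Hy; apply NNPP; intros Hlt; apply Hno.
      exists (x + (y - x) / 3), (x + 2 * ((y - x) / 3)); repeat split; try lra.
      intros u Hu Hau; apply Hlt, Hau; unfold w in *; lra. }
    assert (Hk : forall k x y, c < x -> x < y -> y < d -> INR k * / (INR n + 1) <= h y - h x).
    { induction k as [|k IH]; intros x y Hx Hxy Hy.
      - simpl; assert (h x <= h y) by (apply Hmon; unfold w in *; lra); lra.
      - rewrite S_INR; set (m := (x + y) / 2).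
        assert (x < m < y) by (unfold m; lra).
        specialize (HA x m); specialize (IH m y); lra. }
    set (x := c + (d - c) / 3); set (y := c + 2 * ((d - c) / 3)).
    destruct (INR_unbounded ((h y - h x) * (INR n + 1))) as [k Hkb].
    specialize (Hk k x y).
    assert (INR k * / (INR n + 1) <= h y - h x) by (apply Hk; unfold x, y; lra).
    pose proof (pos_INR n).
    apply (Rmult_le_compat_r (INR n + 1)) in H; [|lra].
    rewrite Rmult_assoc, Rinv_l in H; lra.
  - exists t; split; [unfold w in *; lra|].
    intros eps Heps; destruct (inv_INR_lt eps Heps) as [n Hlt].
    specialize (Hn n); unfold A in Hn.
    apply not_all_ex_not in Hn; destruct Hn as [s Hn].
    apply not_all_ex_not in Hn; destruct Hn as [s' Hn].
    assert (Hs : a < s /\ s < t /\ t < s' /\ s' < b /\ h s' - h s < / (INR n + 1)).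
    { repeat split; apply NNPP; intros Hc; apply Hn; intros; try lra. }
    destruct Hs as (H1 & H2 & H3 & H4 & H5).
    exists (Rmin (t - s) (s' - t)); split; [apply Rmin_glb_lt; lra|].
    pose proof (Rmin_l (t - s) (s' - t)); pose proof (Rmin_r (t - s) (s' - t)).
    intros u Hu1 Hu2.
    assert (h s <= h u) by (apply Hmon; lra).
    assert (h u <= h s') by (apply Hmon; lra).
    assert (h s <= h t) by (apply Hmon; lra).
    assert (h t <= h s') by (apply Hmon; lra).
    lra.
Qed.

(** Four dichotomies, one for each side and each strict order, settle the local behaviour. Every
    combination of outcomes is locally monotone in one direction, except a strict maximum at every
    point or a strict minimum at every point, which are impossible. *)
Lemma definable_monotone_germ (G : R -> R -> Prop) (h : R -> R) (a b : R) :
  definable (fun e => G (e 0%nat) (e 1%nat)) -> a < b ->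
  (forall t, a < t < b -> forall y, G t y <-> y = h t) ->
  exists c, a < c <= b /\ exists s, (s = 1 \/ s = -1) /\
    forall t u, a < t -> t <= u -> u < c -> s * h t <= s * h u.
Proof.
  intros HG Hab Hh.
  assert (Hlt : definable (fun e => e 0%nat < e 1%nat)) by definability.
  assert (Hgt : definable (fun e => e 1%nat < e 0%nat)) by definability.
  assert (sub : forall c, a < c <= b -> forall t, a < t < c -> forall y, G t y <-> y = h t).
  { intros c Hc t Ht; apply Hh; lra. }
  destruct (germ_dichotomy G (fun y y' => y < y') h a b 1) as (c1 & Hc1 & H1); auto.
  destruct (germ_dichotomy G (fun y y' => y' < y) h a c1 1) as (c2 & Hc2 & H2); auto; try lra.
  { apply sub; lra. }
  destruct (germ_dichotomy G (fun y y' => y < y') h a c2 (-1)) as (c3 & Hc3 & H3); auto; try lra.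
  { apply sub; lra. }
  destruct (germ_dichotomy G (fun y y' => y' < y) h a c3 (-1)) as (c & Hc & H4); auto; try lra.
  { apply sub; lra. }
  assert (R1 : forall P : R -> Prop, (forall t, a < t < c1 -> P t) -> forall t, a < t < c -> P t).
  { intros P HP t Ht; apply HP; lra. }
  assert (R2 : forall P : R -> Prop, (forall t, a < t < c2 -> P t) -> forall t, a < t < c -> P t).
  { intros P HP t Ht; apply HP; lra. }
  assert (R3 : forall P : R -> Prop, (forall t, a < t < c3 -> P t) -> forall t, a < t < c -> P t).
  { intros P HP t Ht; apply HP; lra. }
  assert (Weak : forall (P Q : R -> R -> Prop), (forall t k, P t k -> Q t k) ->
    (forall t, a < t < c -> exists d, 0 < d /\ forall k, 0 < k < d -> P t k) ->
    (forall t, a < t < c -> exists d, 0 < d /\ forall k, 0 < k < d -> Q t k)).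
  { intros P Q HPQ HP t Ht; destruct (HP t Ht) as (d & Hd & H); exists d; split; auto. }
  exists c; split; [lra|].
  assert (inc : forall s,
    (forall t, a < t < c -> exists d, 0 < d /\ forall k, 0 < k < d ->
        s * h t <= s * h (t + 1 * k)) ->
    (forall t, a < t < c -> exists d, 0 < d /\ forall k, 0 < k < d ->
        s * h (t + -1 * k) <= s * h t) ->
    forall t u, a < t -> t <= u -> u < c -> s * h t <= s * h u).
  { intros s H5 H6; apply (locally_nondecreasing (fun t => s * h t)); assumption. }
  destruct H2 as [H2|H2]; [|destruct H4 as [H4|H4]].
  - destruct H4 as [H4|H4].
    + exfalso; apply (not_strict_min_everywhere (fun t => - h t) a c); [lra|..].
      * eapply Weak; [|apply R2, H2]; simpl; intros; lra.
      * eapply Weak; [|apply H4]; simpl; intros; lra.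
    + exists (-1); split; [lra|]; apply inc.
      * eapply Weak; [|apply R2, H2]; simpl; intros; lra.
      * eapply Weak; [|apply H4]; simpl; intros; lra.
  - exists 1; split; [lra|]; apply inc.
    * eapply Weak; [|apply R2, H2]; simpl; intros; lra.
    * eapply Weak; [|apply H4]; simpl; intros; lra.
  (* Neither side goes below [h t]. If both are strictly above, [t] is a strict minimum; otherwise
     [h] is constant near [t] on one side, and the other side decides the direction. *)
  - destruct H3 as [H3|H3].
    + destruct H1 as [H1|H1].
      * exfalso; apply (not_strict_min_everywhere h a c); [lra|..].
        -- eapply Weak; [|apply R1, H1]; simpl; intros; lra.
        -- eapply Weak; [|apply R3, H3]; simpl; intros; lra.
      * exists (-1); split; [lra|]; apply inc.
        -- eapply Weak; [|apply R1, H1]; simpl; intros; lra.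
        -- eapply Weak; [|apply R3, H3]; simpl; intros; lra.
    + exists 1; split; [lra|]; apply inc.
      * eapply Weak; [|apply R2, H2]; simpl; intros; lra.
      * eapply Weak; [|apply R3, H3]; simpl; intros; lra.
Qed.

(** Continuity at [t] is a definable property of [t], so near [a] it holds everywhere or nowhere; a
    monotone function has a continuity point in every interval. *)
Lemma definable_continuous_germ (G : R -> R -> Prop) (h : R -> R) (a b s : R) :
  definable (fun e => G (e 0%nat) (e 1%nat)) -> a < b ->
  (forall t, a < t < b -> forall y, G t y <-> y = h t) ->
  (s = 1 \/ s = -1) ->
  (forall t u, a < t -> t <= u -> u < b -> s * h t <= s * h u) ->
  exists c, a < c <= b /\ forall t, a < t < c -> continuous_at h t.
Proof.
  intros HG Hab Hh Hs Hmon.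
  set (C := fun t => forall eps, 0 < eps -> exists d, 0 < d /\
    forall u, - d < u - t -> u - t < d -> forall y y', G t y -> G u y' ->
      - eps < y' - y /\ y' - y < eps).
  assert (HC : forall t, a < t < b -> (C t <-> continuous_at h t)).
  { intros t Ht; split; intros H eps Heps; destruct (H eps Heps) as (d & Hd & H').
    - exists (Rmin d (Rmin (t - a) (b - t))); split.
      { repeat apply Rmin_glb_lt; lra. }
      pose proof (Rmin_l d (Rmin (t - a) (b - t))); pose proof (Rmin_r d (Rmin (t - a) (b - t))).
      pose proof (Rmin_l (t - a) (b - t)); pose proof (Rmin_r (t - a) (b - t)).
      intros u Hu1 Hu2; apply (H' u); try (apply Hh); auto; lra.
    - exists (Rmin d (Rmin (t - a) (b - t))); split.
      { repeat apply Rmin_glb_lt; lra. }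
      pose proof (Rmin_l d (Rmin (t - a) (b - t))); pose proof (Rmin_r d (Rmin (t - a) (b - t))).
      pose proof (Rmin_l (t - a) (b - t)); pose proof (Rmin_r (t - a) (b - t)).
      intros u Hu1 Hu2 y y' Hy Hy'; apply Hh in Hy; [|lra]; apply Hh in Hy'; [|lra]; subst.
      apply H'; lra. }
  destruct (definable_germ C a 1) as (eps & Heps & H).
  { unfold C; definability; (apply definable_rel; [assumption|polyfunc..]). }
  destruct H as [H|H].
  - exists (Rmin b (a + eps)); split.
    { split; [apply Rmin_glb_lt; lra|apply Rmin_l]. }
    intros t Ht; pose proof (Rmin_l b (a + eps)); pose proof (Rmin_r b (a + eps)).
    apply HC; [lra|]; replace t with (a + 1 * (t - a)) by ring; apply H; lra.
  - exfalso; set (c := Rmin b (a + eps)).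
    assert (Hc : a < c) by (apply Rmin_glb_lt; lra).
    pose proof (Rmin_l b (a + eps)) as Hcb; pose proof (Rmin_r b (a + eps)) as Hce.
    fold c in Hcb, Hce.
    destruct (nondecreasing_continuity_point (fun t => s * h t) a c Hc) as (t & Ht & Hcont).
    { intros; apply Hmon; lra. }
    apply (H (t - a)); [lra|]; replace (a + 1 * (t - a)) with t by ring.
    apply HC; [lra|]; intros e He; destruct (Hcont e He) as (d & Hd & H'); exists d.
    split; [lra|]; intros u Hu1 Hu2; destruct (H' u Hu1 Hu2); destruct Hs as [-> | ->]; lra.
Qed.

(** * Polynomials on a box *)

Lemma rsum_ext n F G : (forall k, (k < n)%nat -> F k = G k) -> rsum n F = rsum n G.
Proof.
  induction n as [|n IH]; intros H; simpl; [reflexivity|].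
  rewrite IH, H by auto; reflexivity.
Qed.

Lemma rsum_le n F G : (forall k, (k < n)%nat -> F k <= G k) -> rsum n F <= rsum n G.
Proof.
  induction n as [|n IH]; intros H; simpl; [lra|].
  apply Rplus_le_compat; [apply IH; intros; apply H; lia|apply H; lia].
Qed.

Lemma rsum_plus n F G : rsum n (fun k => F k + G k) = rsum n F + rsum n G.
Proof. induction n as [|n IH]; simpl; [ring|rewrite IH; ring]. Qed.

Lemma rsum_scal n c F : rsum n (fun k => c * F k) = c * rsum n F.
Proof. induction n as [|n IH]; simpl; [ring|rewrite IH; ring]. Qed.

Lemma rsum_const n c : rsum n (fun _ => c) = INR n * c.
Proof. induction n as [|n IH]; [simpl; ring|]. rewrite S_INR; simpl; rewrite IH; ring. Qed.

Lemma rsum_nonneg n F : (forall k, (k < n)%nat -> 0 <= F k) -> 0 <= rsum n F.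
Proof.
  intros H; rewrite <- (Rmult_0_r (INR n)), <- rsum_const; apply rsum_le; exact H.
Qed.

Lemma rsum_term_le n F k : (forall j, (j < n)%nat -> 0 <= F j) -> (k < n)%nat -> F k <= rsum n F.
Proof.
  induction n as [|n IH]; intros H Hk; [lia|]; simpl.
  assert (0 <= rsum n F) by (apply rsum_nonneg; intros; apply H; lia).
  destruct (Nat.eq_dec k n) as [->|]; [lra|].
  assert (F k <= rsum n F) by (apply IH; [intros; apply H|]; lia).
  specialize (H n); assert (0 <= F n) by (apply H; lia); lra.
Qed.

Lemma rsum_delta n c j F : (j < n)%nat ->
  rsum n (fun k => (if Nat.eqb j k then c else 0) * F k) = c * F j.
Proof.
  induction n as [|n IH]; intros Hj; [lia|]; simpl.
  destruct (Nat.eq_dec j n) as [->|Hne].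
  - rewrite Nat.eqb_refl, (rsum_ext _ _ (fun _ => 0)), rsum_const; [ring|].
    intros k Hk; destruct (Nat.eqb_spec n k); [lia|ring].
  - rewrite IH by lia; destruct (Nat.eqb_spec j n); [lia|ring].
Qed.

Lemma peval_ext n p x y : pvars_in (fun k => (k < n)%nat) p ->
  (forall k, (k < n)%nat -> x k = y k) -> peval x p = peval y p.
Proof.
  intros Hp Hxy; induction p as [c|k|a IHa b IHb|a IHa b IHb]; simpl in *; auto;
    destruct Hp; rewrite IHa, IHb by assumption; reflexivity.
Qed.

Lemma pvars_in_pderiv A k p : pvars_in A p -> pvars_in A (pderiv k p).
Proof.
  induction p as [c|j|a IHa b IHb|a IHa b IHb]; simpl; try tauto.
  destruct (Nat.eqb j k); simpl; auto.
Qed.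

Lemma pvars_in_weaken (A B : nat -> Prop) p : (forall k, A k -> B k) -> pvars_in A p -> pvars_in B p.
Proof.
  intros H; induction p as [c|j|a IHa b IHb|a IHa b IHb]; simpl; auto; tauto.
Qed.

Definition dist1 (n : nat) (x y : nat -> R) : R := rsum n (fun k => Rabs (x k - y k)).

Lemma dist1_nonneg n x y : 0 <= dist1 n x y.
Proof. apply rsum_nonneg; intros; apply Rabs_pos. Qed.

Lemma dist1_term n x y k : (k < n)%nat -> Rabs (x k - y k) <= dist1 n x y.
Proof.
  intros Hk; apply (rsum_term_le n (fun k => Rabs (x k - y k))); auto.
  intros; apply Rabs_pos.
Qed.

Definition dirderiv (n : nat) (p : mpoly) (x d : nat -> R) : R :=
  rsum n (fun k => grad p x k * d k).

(** Size, Lipschitz and Taylor bounds are proved together because the product case of the induction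
    needs all three. The remainder of a product splits into three terms, each at most [Ma * Mb]
    times the squared distance, hence the factor 3. *)
Lemma poly_bounds n lo hi p : pvars_in (fun k => (k < n)%nat) p ->
  exists M, 0 <= M /\ forall x y, inZ n lo hi x -> inZ n lo hi y ->
    Rabs (peval x p) <= M /\
    Rabs (peval y p - peval x p) <= M * dist1 n y x /\
    Rabs (peval y p - peval x p - dirderiv n p x (fun k => y k - x k)) <= M * dist1 n y x ^ 2.
Proof.
  unfold dirderiv, grad.
  induction p as [c|j|a IHa b IHb|a IHa b IHb]; simpl; intros Hp.
  - exists (Rabs c); split; [apply Rabs_pos|]; intros x y _ _.
    rewrite (rsum_ext _ _ (fun _ => 0)) by (intros; ring); rewrite rsum_const.
    pose proof (Rabs_pos c); pose proof (dist1_nonneg n y x).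
    replace (c - c - INR n * 0) with 0 by ring; replace (c - c) with 0 by ring.
    rewrite Rabs_R0; repeat split; [lra|nra|apply Rmult_le_pos; nra].
  - exists (Rabs (lo j) + Rabs (hi j) + 1).
    pose proof (Rabs_pos (lo j)); pose proof (Rabs_pos (hi j)).
    split; [lra|]; intros x y Hx Hy.
    rewrite (rsum_ext _ _ (fun k => (if Nat.eqb j k then 1 else 0) * (y k - x k))).
    2: { intros k _; destruct (Nat.eqb j k); simpl; ring. }
    rewrite rsum_delta by assumption.
    pose proof (dist1_nonneg n y x); pose proof (dist1_term n y x j Hp).
    replace (y j - x j - 1 * (y j - x j)) with 0 by ring; rewrite Rabs_R0.
    repeat split.
    + specialize (Hx j Hp).
      unfold Rabs in *; destruct (Rcase_abs (x j)), (Rcase_abs (lo j)), (Rcase_abs (hi j)); lra.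
    + nra.
    + apply Rmult_le_pos; nra.
  - destruct Hp as [Ha Hb].
    destruct (IHa Ha) as (Ma & HMa & Ba); destruct (IHb Hb) as (Mb & HMb & Bb).
    exists (Ma + Mb); split; [lra|]; intros x y Hx Hy.
    destruct (Ba x y Hx Hy) as (A1 & A2 & A3); destruct (Bb x y Hx Hy) as (B1 & B2 & B3).
    rewrite (rsum_ext _ _ (fun k => peval x (pderiv k a) * (y k - x k)
                                  + peval x (pderiv k b) * (y k - x k))) by (intros; ring).
    rewrite rsum_plus.
    repeat split.
    + eapply Rle_trans; [apply Rabs_triang|lra].
    + replace (peval y a + peval y b - (peval x a + peval x b))
        with ((peval y a - peval x a) + (peval y b - peval x b)) by ring.
      eapply Rle_trans; [apply Rabs_triang|lra].
    + match goal with |- Rabs (?ya + ?yb - (?xa + ?xb) - (?da + ?db)) <= _ =>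
        replace (ya + yb - (xa + xb) - (da + db)) with ((ya - xa - da) + (yb - xb - db)) by ring
      end.
      eapply Rle_trans; [apply Rabs_triang|lra].
  - destruct Hp as [Ha Hb].
    destruct (IHa Ha) as (Ma & HMa & Ba); destruct (IHb Hb) as (Mb & HMb & Bb).
    exists (3 * (Ma * Mb)); split; [nra|]; intros x y Hx Hy.
    destruct (Ba x y Hx Hy) as (A1 & A2 & A3); destruct (Bb x y Hx Hy) as (B1 & B2 & B3).
    destruct (Ba y x Hy Hx) as (A1y & _ & _).
    rewrite (rsum_ext _ _ (fun k => peval x b * (peval x (pderiv k a) * (y k - x k))
                          + peval x a * (peval x (pderiv k b) * (y k - x k)))) by (intros; ring).
    rewrite rsum_plus, !rsum_scal.
    assert (HMM : 0 <= Ma * Mb) by nra.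
    pose proof (dist1_nonneg n y x) as Hd.
    set (D := dist1 n y x) in *.
    set (da := rsum n (fun k => peval x (pderiv k a) * (y k - x k))) in *.
    set (db := rsum n (fun k => peval x (pderiv k b) * (y k - x k))) in *.
    assert (prod : forall u v U V, Rabs u <= U -> Rabs v <= V -> Rabs (u * v) <= U * V).
    { intros u v U V Hu Hv; rewrite Rabs_mult; apply Rmult_le_compat; auto using Rabs_pos. }
    repeat split.
    + pose proof (prod _ _ _ _ A1 B1); lra.
    + replace (peval y a * peval y b - peval x a * peval x b)
        with (peval y a * (peval y b - peval x b) + (peval y a - peval x a) * peval x b) by ring.
      pose proof (prod _ _ _ _ A1y B2); pose proof (prod _ _ _ _ A2 B1).
      eapply Rle_trans; [apply Rabs_triang|].
      assert (0 <= Ma * Mb * D) by (apply Rmult_le_pos; lra); lra.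
    + replace (peval y a * peval y b - peval x a * peval x b - (peval x b * da + peval x a * db))
        with ((peval y a - peval x a - da) * peval x b
              + peval x a * (peval y b - peval x b - db)
              + (peval y a - peval x a) * (peval y b - peval x b)) by ring.
      pose proof (prod _ _ _ _ A3 B1); pose proof (prod _ _ _ _ A1 B3).
      pose proof (prod _ _ _ _ A2 B2).
      eapply Rle_trans; [apply Rabs_triang|].
      pose proof (Rabs_triang ((peval y a - peval x a - da) * peval x b)
                              (peval x a * (peval y b - peval x b - db))).
      lra.
Qed.

Lemma uniform_bound n (Q : nat -> R -> Prop) :
  (forall k M M', Q k M -> M <= M' -> Q k M') ->
  (forall k, (k < n)%nat -> exists M, Q k M) ->
  exists M, 0 <= M /\ forall k, (k < n)%nat -> Q k M.
Proof.
  intros Hmon; induction n as [|n IH]; intros H; [exists 0; split; [lra|lia]|].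
  destruct IH as (M & HM & HQ); [intros; apply H; lia|].
  destruct (H n) as [M' HM']; [lia|].
  exists (Rmax M M'); split; [pose proof (Rmax_l M M'); lra|].
  intros k Hk; destruct (Nat.eq_dec k n) as [->|].
  - apply Hmon with M'; [assumption|apply Rmax_r].
  - apply Hmon with M; [apply HQ; lia|apply Rmax_l].
Qed.

Lemma grad_bounds n lo hi p : pvars_in (fun k => (k < n)%nat) p ->
  exists M, 0 <= M /\ forall k, (k < n)%nat -> forall x y, inZ n lo hi x -> inZ n lo hi y ->
    Rabs (grad p x k) <= M /\ Rabs (grad p y k - grad p x k) <= M * dist1 n y x.
Proof.
  intros Hp; apply (uniform_bound n (fun k M => forall x y, inZ n lo hi x -> inZ n lo hi y ->
    Rabs (grad p x k) <= M /\ Rabs (grad p y k - grad p x k) <= M * dist1 n y x)).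
  - intros k M M' H HM x y Hx Hy; destruct (H x y Hx Hy); split; [lra|].
    pose proof (dist1_nonneg n y x); nra.
  - intros k _; destruct (poly_bounds n lo hi (pderiv k p)) as (M & _ & H);
      [apply pvars_in_pderiv, Hp|].
    exists M; intros x y Hx Hy; destruct (H x y Hx Hy) as (H1 & H2 & _); auto.
Qed.

Lemma rsum_cv n (U : nat -> nat -> R) (L : nat -> R) :
  (forall k, (k < n)%nat -> Un_cv (fun l => U l k) (L k)) ->
  Un_cv (fun l => rsum n (U l)) (rsum n L).
Proof.
  induction n as [|n IH]; intros H; simpl.
  - intros eps Heps; exists 0%nat; intros; unfold Rdist; rewrite Rminus_diag, Rabs_R0; exact Heps.
  - apply (CV_plus (fun l => rsum n (U l)) (fun l => U l n)); [apply IH; intros|]; apply H; lia.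
Qed.

Lemma Un_cv_const c : Un_cv (fun _ => c) c.
Proof.
  intros eps Heps; exists 0%nat; intros; unfold Rdist; rewrite Rminus_diag, Rabs_R0; exact Heps.
Qed.

Lemma peval_cv n p (x : nat -> nat -> R) (l : nat -> R) : pvars_in (fun k => (k < n)%nat) p ->
  (forall k, (k < n)%nat -> Un_cv (fun j => x j k) (l k)) ->
  Un_cv (fun j => peval (x j) p) (peval l p).
Proof.
  intros Hp Hx; induction p as [c|k|a IHa b IHb|a IHa b IHb]; simpl in *.
  - apply Un_cv_const.
  - apply Hx, Hp.
  - apply CV_plus; tauto.
  - apply CV_mult; tauto.
Qed.

Lemma cv_le_const (u : nat -> R) l c : Un_cv u l -> (forall n, u n <= c) -> l <= c.
Proof. intros Hu H; apply (@Rle_cv_lim u (fun _ => c) l c); auto using Un_cv_const. Qed.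

Lemma cv_ge_const (u : nat -> R) l c : Un_cv u l -> (forall n, c <= u n) -> c <= l.
Proof. intros Hu H; apply (@Rle_cv_lim (fun _ => c) u c l); auto using Un_cv_const. Qed.

(** * Lexicographic minima of definable compact sets *)

Lemma Un_cv_subseq (u : nat -> R) l (phi : nat -> nat) :
  (forall n, (n <= phi n)%nat) -> Un_cv u l -> Un_cv (fun n => u (phi n)) l.
Proof.
  intros Hphi Hu eps Heps; destruct (Hu eps Heps) as [N HN]; exists N.
  intros n Hn; apply HN; specialize (Hphi n); lia.
Qed.

(** [phi] is only asked to dominate the identity, which suffices for limits and is stable under
    composition. *)
Lemma bounded_subseq (u : nat -> R) M : (forall n, Rabs (u n) <= M) ->
  exists l (phi : nat -> nat), (forall n, (n <= phi n)%nat) /\ Un_cv (fun n => u (phi n)) l.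
Proof.
  intros Hu.
  destruct (Bolzano_Weierstrass u (fun c => - M <= c <= M)) as [l Hl].
  - apply compact_P3.
  - intros n; specialize (Hu n); unfold Rabs in Hu; destruct (Rcase_abs (u n)); lra.
  - exists l.
    assert (H : forall n, exists p, (n <= p)%nat /\ Rabs (u p - l) < / (INR n + 1)).
    { intros n; assert (Hp : 0 < / (INR n + 1)).
      { apply Rinv_0_lt_compat; pose proof (pos_INR n); lra. }
      destruct (Hl (fun x => Rabs (x - l) < / (INR n + 1)) n) as (p & Hp1 & Hp2).
      - exists (mkposreal _ Hp); intros x Hx; exact Hx.
      - exists p; split; assumption. }
    destruct (choice _ H) as [phi Hphi]; exists phi; split; [apply Hphi|].
    intros eps Heps; destruct (inv_INR_lt eps Heps) as [N HN].
    exists N; intros n Hn; unfold Rdist.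
    eapply Rlt_le_trans; [apply Hphi|]; apply Rlt_le.
    eapply Rle_lt_trans; [|exact HN].
    apply Rinv_le_contravar; [pose proof (pos_INR N); lra|].
    apply le_INR in Hn; lra.
Qed.

Lemma bounded_subseq_vec N (v : nat -> nat -> R) M :
  (forall j k, (k < N)%nat -> Rabs (v j k) <= M) ->
  exists (l : nat -> R) (phi : nat -> nat), (forall n, (n <= phi n)%nat) /\
    forall k, (k < N)%nat -> Un_cv (fun n => v (phi n) k) (l k).
Proof.
  induction N as [|N IH]; intros Hv.
  - exists (fun _ => 0), (fun n => n); split; [auto|lia].
  - destruct IH as (l & phi & Hphi & Hl); [intros; apply Hv; lia|].
    destruct (bounded_subseq (fun n => v (phi n) N) M) as (c & psi & Hpsi & Hc).
    { intros n; apply Hv; lia. }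
    exists (fun k => if Nat.eqb k N then c else l k), (fun n => phi (psi n)); split.
    + intros n; specialize (Hpsi n); specialize (Hphi (psi n)); lia.
    + intros k Hk; destruct (Nat.eqb_spec k N) as [->|]; [exact Hc|].
      apply (Un_cv_subseq (fun n => v (phi n) k)); [exact Hpsi|apply Hl; lia].
Qed.

(* Compactness of a set of vectors in their first N coordinates; the constant
   sequences show that membership only depends on these coordinates. *)
Definition compact_set (N : nat) (A : (nat -> R) -> Prop) : Prop :=
  (exists M, forall v k, A v -> (k < N)%nat -> Rabs (v k) <= M) /\
  (forall (v : nat -> nat -> R) w, (forall j, A (v j)) ->
     (forall k, (k < N)%nat -> Un_cv (fun j => v j k) (w k)) -> A w).

Lemma compact_set_ext N A v w : compact_set N A -> A v ->
  (forall k, (k < N)%nat -> v k = w k) -> A w.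
Proof.
  intros [_ HA] Hv Hvw; apply (HA (fun _ => v)); auto.
  intros k Hk; rewrite Hvw by assumption; apply Un_cv_const.
Qed.

Definition minimizers (j : nat) (A : (nat -> R) -> Prop) (v : nat -> R) : Prop :=
  A v /\ forall w, A w -> v j <= w j.

Lemma minimizers_nonempty N j A : compact_set N A -> (j < N)%nat -> (exists v, A v) ->
  exists v, minimizers j A v.
Proof.
  intros [[M HM] HA] Hj [v0 Hv0].
  destruct (completeness (fun x => exists v, A v /\ x = - v j)) as [m [Hub Hlub]].
  { exists M; intros x (v & Hv & ->); specialize (HM v j Hv Hj).
    unfold Rabs in HM; destruct (Rcase_abs (v j)); lra. }
  { exists (- v0 j), v0; auto. }
  assert (Hle : forall v, A v -> - m <= v j).
  { intros v Hv; assert (- v j <= m) by (apply Hub; eauto); lra. }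
  assert (H : forall n : nat, exists v, A v /\ v j < - m + / (INR n + 1)).
  { intros n; assert (0 < / (INR n + 1)).
    { apply Rinv_0_lt_compat; pose proof (pos_INR n); lra. }
    apply NNPP; intros Hno.
    assert (m <= m - / (INR n + 1)); [|lra].
    apply Hlub; intros x (v & Hv & ->); apply Rnot_lt_le; intros Hlt.
    apply Hno; exists v; split; [exact Hv|lra]. }
  destruct (choice _ H) as [v Hv].
  destruct (bounded_subseq_vec N v M) as (w & phi & Hphi & Hw).
  { intros i k Hk; apply HM; [apply Hv|exact Hk]. }
  exists w; split.
  - apply (HA (fun n => v (phi n))); [intros i; apply Hv|exact Hw].
  - intros u Hu; apply Rle_trans with (- m); [|apply Hle, Hu].
    apply Rnot_lt_le; intros Hlt.
    destruct (Hw j Hj ((w j + m) / 2)) as [n1 H1]; [lra|].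
    destruct (inv_INR_lt ((w j + m) / 2)) as [n2 H2]; [lra|].
    set (n := Nat.max n1 n2).
    specialize (H1 n ltac:(unfold n; lia)); unfold Rdist in H1; apply Rabs_def2 in H1.
    destruct (Hv (phi n)) as [_ H3].
    assert (/ (INR (phi n) + 1) <= / (INR n2 + 1)).
    { apply Rinv_le_contravar; [pose proof (pos_INR n2); lra|].
      assert (n2 <= phi n)%nat by (specialize (Hphi n); unfold n in *; lia).
      apply le_INR in H0; lra. }
    lra.
Qed.

Lemma minimizers_compact N j A : compact_set N A -> (j < N)%nat ->
  compact_set N (minimizers j A).
Proof.
  intros [[M HM] HA] Hj; split.
  - exists M; intros v k [Hv _]; apply HM, Hv.
  - intros v w Hv Hw; split.
    + apply (HA v); auto; intros i; apply Hv.
    + intros u Hu; apply (cv_le_const (fun i => v i j)); [apply Hw, Hj|].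
      intros i; apply (Hv i), Hu.
Qed.

(** Coordinate [n] is minimised first, then 0, ..., m - 1 in turn. With [m = n] the first n + 1
    coordinates are determined, which gives a definable choice of a point in each member of a
    definable compact family. *)
Fixpoint lexmin (n m : nat) (A : (nat -> R) -> Prop) : (nat -> R) -> Prop :=
  match m with
  | O => minimizers n A
  | S m' => minimizers m' (lexmin n m' A)
  end.

Lemma lexmin_compact n m A : compact_set (S n) A -> (m <= n)%nat ->
  compact_set (S n) (lexmin n m A).
Proof.
  intros HA; induction m as [|m IH]; intros Hm; simpl; apply minimizers_compact; auto; try lia.
  apply IH; lia.
Qed.

Lemma lexmin_nonempty n m A : compact_set (S n) A -> (m <= n)%nat -> (exists v, A v) ->
  exists v, lexmin n m A v.
Proof.
  intros HA; induction m as [|m IH]; intros Hm Hne; simpl; apply (minimizers_nonempty (S n)); auto.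
  - apply lexmin_compact; auto; lia.
  - apply IH; auto; lia.
Qed.

Lemma lexmin_sub n m A v : lexmin n m A v -> A v.
Proof. induction m as [|m IH]; intros [H _]; auto. Qed.

Lemma lexmin_min n m A v w : lexmin n m A v -> A w -> v n <= w n.
Proof.
  induction m as [|m IH]; simpl; intros [H1 H2] Hw; auto.
Qed.

Lemma lexmin_unique n m A v w : lexmin n m A v -> lexmin n m A w ->
  v n = w n /\ forall k, (k < m)%nat -> v k = w k.
Proof.
  induction m as [|m IH]; simpl; intros [Hv1 Hv2] [Hw1 Hw2].
  - split; [apply Rle_antisym; auto|lia].
  - destruct (IH Hv1 Hw1) as [H1 H2]; split; [exact H1|].
    intros k Hk; destruct (Nat.eq_dec k m) as [->|]; [apply Rle_antisym; auto|apply H2; lia].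
Qed.

(** The invariance hypothesis lets the whole environment [e] stand for the vector, its entries from
    [N] on being ignored; the quantifier then amounts to [N] real ones. *)
Lemma definable_ex_vec N (B : (nat -> R) -> (nat -> R) -> Prop) :
  (forall v w e, (forall k, (k < N)%nat -> v k = w k) -> B v e -> B w e) ->
  definable (fun e => B e (fun i => e (N + i)%nat)) ->
  definable (fun e => exists v, B v e).
Proof.
  revert B; induction N as [|N IH]; intros B HB HD.
  - revert HD; apply definable_ext; intros e; split; [eauto|].
    intros [v Hv]; apply (HB v); [lia|exact Hv].
  (* The outermost real becomes coordinate [N]; the coordinates below [N] are left to the induction
     hypothesis. *)
  - set (B' := fun v e => B (fun i => if Nat.eqb i N then e 0%nat else v i)
                            (fun i => e (S i))).
    apply definable_ext with (fun e => exists x, exists v, B' v (scons x e)).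
    { intros e; unfold B'; simpl; split.
      - intros (x & v & Hv); eexists; exact Hv.
      - intros (v & Hv); exists (v N), v; revert Hv; apply HB.
        intros k Hk; destruct (Nat.eqb_spec k N); congruence. }
    apply (definable_ex (fun x e => exists v, B' v (scons x e))).
    apply (definable_ext (fun e => exists v, B' v e)).
    { intros e; replace (scons (e 0%nat) (fun i => e (S i))) with e; [tauto|].
      apply functional_extensionality; intros [|i]; reflexivity. }
    apply IH.
    + unfold B'; intros v w e Hvw; apply HB; intros k Hk.
      destruct (Nat.eqb_spec k N); [reflexivity|apply Hvw; lia].
    + revert HD; apply definable_ext; intros e; unfold B'.
      replace (fun i => if Nat.eqb i N then e (N + 0)%nat else e i) with e.
      2: { apply functional_extensionality; intros i.
           destruct (Nat.eqb_spec i N) as [->|]; [rewrite Nat.add_0_r|]; reflexivity. }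
      replace (fun i => e (N + S i)%nat) with (fun i => e (S N + i)%nat); [tauto|].
      apply functional_extensionality; intros i; f_equal; lia.
Qed.

Definition definable_family (A : R -> (nat -> R) -> Prop) : Prop :=
  definable (fun e => A (e 0%nat) (fun i => e (S i))).

Lemma definable_family_comp A (r : nat -> nat) j : definable_family A ->
  definable (fun e => A (e j) (fun i => e (r i))).
Proof.
  intros HA; apply (definable_comp _
    (fun i => match i with O => fun e => e j | S i' => fun e => e (r i') end) HA).
  intros [|i]; polyfunc.
Qed.

Lemma definable_minimizers N j A :
  (forall t v w, A t v -> (forall k, (k < N)%nat -> v k = w k) -> A t w) -> (j < N)%nat ->
  definable_family A -> definable_family (fun t => minimizers j (A t)).
Proof.
  intros Hext Hj HA; unfold definable_family, minimizers.
  apply definable_and; [exact HA|].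
  apply definable_ext with (fun e => ~ exists w, A (e 0%nat) w /\ w j < e (S j)).
  - intros e; split; intros H.
    + intros w Hw; apply Rnot_lt_le; intros Hlt; apply H; eauto.
    + intros (w & Hw & Hlt); specialize (H w Hw); lra.
  - apply definable_not, (definable_ex_vec N).
    + intros v w e Hvw [H1 H2]; split; [eapply Hext; eauto|rewrite <- Hvw; assumption].
    + apply definable_and; [|definability].
      apply (definable_family_comp A (fun i => i)), HA.
Qed.

Lemma definable_lexmin n m A : (forall t, compact_set (S n) (A t)) -> (m <= n)%nat ->
  definable_family A -> definable_family (fun t => lexmin n m (A t)).
Proof.
  intros HC Hm HA; induction m as [|m IH]; simpl; apply (definable_minimizers (S n)); auto; try lia.
  - intros t v w; apply compact_set_ext, HC.
  - intros t v w; apply compact_set_ext, lexmin_compact; [apply HC|lia].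
  - apply IH; lia.
Qed.

(** * The Kurdyka-Lojasiewicz inequality on a box *)

(* [r] bounds every coordinate of the projection of [- grad f x] on the tangent
   cone of the box at [x]. *)
Definition residual (n : nat) (lo hi : nat -> R) (f : mpoly) (x : nat -> R) (r : R) : Prop :=
  0 <= r /\ forall k, (k < n)%nat ->
    (lo k < x k -> grad f x k <= r) /\ (x k < hi k -> - r <= grad f x k).

Lemma grad_ext n f x y k : pvars_in (fun k => (k < n)%nat) f ->
  (forall k, (k < n)%nat -> x k = y k) -> grad f x k = grad f y k.
Proof. intros Hf; apply peval_ext, pvars_in_pderiv, Hf. Qed.

Lemma residual_ext n lo hi f x y r : pvars_in (fun k => (k < n)%nat) f ->
  (forall k, (k < n)%nat -> x k = y k) -> residual n lo hi f x r -> residual n lo hi f y r.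
Proof.
  intros Hf Hxy [Hr H]; split; [exact Hr|]; intros k Hk.
  rewrite <- (Hxy k Hk), <- (grad_ext n f x y k Hf Hxy); apply H, Hk.
Qed.

Lemma cv_eventually_gt (u : nat -> R) l c : Un_cv u l -> c < l ->
  exists N, forall n, (N <= n)%nat -> c < u n.
Proof.
  intros Hu Hl; destruct (Hu (l - c)) as [N HN]; [lra|]; exists N; intros n Hn.
  specialize (HN n Hn); unfold Rdist in HN; apply Rabs_def2 in HN; lra.
Qed.

(** A bound that is inactive at the limit is inactive along a tail of the sequence, so its sign
    condition passes to the limit; a bound that becomes active only removes a condition. *)
Lemma residual_closed n lo hi f (x : nat -> nat -> R) y (r : nat -> R) r0 :
  pvars_in (fun k => (k < n)%nat) f ->
  (forall j, residual n lo hi f (x j) (r j)) ->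
  (forall k, (k < n)%nat -> Un_cv (fun j => x j k) (y k)) -> Un_cv r r0 ->
  residual n lo hi f y r0.
Proof.
  intros Hf Hres Hx Hr; split.
  - apply (cv_ge_const r); [exact Hr|]; intros j; apply Hres.
  - intros k Hk.
    assert (Hg : Un_cv (fun j => grad f (x j) k) (grad f y k)).
    { apply (peval_cv n); [apply pvars_in_pderiv, Hf|exact Hx]. }
    split; intros Hb; apply Rnot_lt_le; intros Hlt.
    + destruct (cv_eventually_gt _ _ (lo k) (Hx k Hk) Hb) as [N1 H1].
      destruct (cv_eventually_gt _ _ 0 (CV_minus _ _ _ _ Hg Hr)) as [N2 H2]; [lra|].
      specialize (H1 (Nat.max N1 N2) ltac:(lia)); specialize (H2 (Nat.max N1 N2) ltac:(lia)).
      destruct (Hres (Nat.max N1 N2)) as [_ H]; destruct (H k Hk) as [H3 _]; apply H3 in H1; lra.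
    + destruct (cv_eventually_gt _ _ (- hi k) (CV_opp _ _ (Hx k Hk))) as [N1 H1]; [lra|].
      destruct (cv_eventually_gt _ _ 0 (CV_opp _ _ (CV_plus _ _ _ _ Hg Hr))) as [N2 H2]; [lra|].
      specialize (H1 (Nat.max N1 N2) ltac:(lia)); specialize (H2 (Nat.max N1 N2) ltac:(lia)).
      destruct (Hres (Nat.max N1 N2)) as [_ H]; destruct (H k Hk) as [_ H3]; unfold opp_seq in *.
      assert (x (Nat.max N1 N2) k < hi k) as H4 by lra; apply H3 in H4; lra.
Qed.

(** A feasible displacement decreases a coordinate only above its lower bound and increases it only
    below its upper bound, exactly where [r] controls the partial derivative. The maximum norm of
    the projected gradient is paired with the 1-norm [dist1]. *)
Lemma residual_dirderiv n lo hi f x y r : inZ n lo hi x -> inZ n lo hi y ->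
  residual n lo hi f x r -> - dirderiv n f x (fun k => y k - x k) <= r * dist1 n y x.
Proof.
  intros Hx Hy [Hr Hres]; unfold dirderiv, dist1.
  rewrite <- rsum_scal.
  replace (- rsum n (fun k => grad f x k * (y k - x k)))
    with (rsum n (fun k => -1 * (grad f x k * (y k - x k)))) by (rewrite rsum_scal; ring).
  apply rsum_le; intros k Hk; destruct (Hres k Hk) as [H1 H2].
  specialize (Hx k Hk); specialize (Hy k Hk).
  destruct (Rtotal_order (y k) (x k)) as [Hlt|[Heq|Hlt]].
  - rewrite Rabs_left by lra; assert (grad f x k <= r) by (apply H1; lra); nra.
  - rewrite Heq, Rminus_diag, Rabs_R0; lra.
  - rewrite Rabs_right by lra; assert (- r <= grad f x k) by (apply H2; lra); nra.
Qed.

(* The coordinate n of [v] is a residual bound at the point with coordinates 0, ..., n - 1. *)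
Definition slice (n : nat) (lo hi : nat -> R) (f : mpoly) (K t : R) (v : nat -> R) : Prop :=
  inZ n lo hi v /\ peval v f = t /\ residual n lo hi f v (v n) /\ v n <= K.

Lemma slice_compact n lo hi f K t : pvars_in (fun k => (k < n)%nat) f ->
  compact_set (S n) (slice n lo hi f K t).
Proof.
  intros Hf; split.
  - destruct (uniform_bound n (fun k M => Rabs (lo k) <= M /\ Rabs (hi k) <= M))
      as (M & HM & H).
    + intros k M M' [? ?] ?; lra.
    + intros k _; exists (Rabs (lo k) + Rabs (hi k)).
      pose proof (Rabs_pos (lo k)); pose proof (Rabs_pos (hi k)); lra.
    + exists (Rmax M K); intros v k (Hv & _ & [Hr _] & HK) Hk.
      pose proof (Rmax_l M K); pose proof (Rmax_r M K).
      destruct (Nat.eq_dec k n) as [->|]; [rewrite Rabs_right by lra; lra|].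
      destruct (Hv k ltac:(lia)); destruct (H k ltac:(lia)).
      unfold Rabs in *; destruct (Rcase_abs (v k)), (Rcase_abs (lo k)), (Rcase_abs (hi k)); lra.
  - intros v w Hv Hw.
    assert (Hw' : forall k, (k < n)%nat -> Un_cv (fun j => v j k) (w k)) by (intros; apply Hw; lia).
    repeat split.
    + apply (cv_ge_const (fun j => v j k)); [auto|]; intros j; apply (Hv j); assumption.
    + apply (cv_le_const (fun j => v j k)); [auto|]; intros j; apply (Hv j); assumption.
    + apply (UL_sequence (fun j => peval (v j) f)); [apply (peval_cv n); assumption|].
      replace (fun j => peval (v j) f) with (fun _ : nat => t); [apply Un_cv_const|].
      apply functional_extensionality; intros j; symmetry; apply (Hv j).
    + apply (cv_ge_const (fun j => v j n)); [auto|]; intros j; apply (Hv j).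
    + apply (residual_closed n lo hi f v w (fun j => v j n) (w n)); auto; intros j; apply Hv.
    + apply (residual_closed n lo hi f v w (fun j => v j n) (w n)); auto; intros j; apply Hv.
    + apply (cv_le_const (fun j => v j n)); [auto|]; intros j; apply (Hv j).
Qed.

Lemma definable_all_lt n (A : nat -> (nat -> R) -> Prop) :
  (forall k, (k < n)%nat -> definable (A k)) ->
  definable (fun e => forall k, (k < n)%nat -> A k e).
Proof.
  induction n as [|n IH]; intros H.
  - apply definable_ext with (fun e => 0 <= 0).
    + intros e; split; [intros; lia|lra].
    + definability.
  - apply definable_ext with (fun e => (forall k, (k < n)%nat -> A k e) /\ A n e).
    + intros e; split.
      * intros [H1 H2] k Hk; destruct (Nat.eq_dec k n) as [->|]; [exact H2|apply H1; lia].
      * intros H1; split; [intros|]; apply H1; lia.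
    + apply definable_and; [apply IH; intros|]; apply H; lia.
Qed.

Lemma definable_slice n lo hi f K : definable_family (slice n lo hi f K).
Proof.
  unfold definable_family, slice, inZ, residual, grad.
  definability; apply definable_all_lt; intros k Hk; definability.
Qed.

Lemma uniform_germ n (a : R) (Q : nat -> R -> Prop) :
  (forall k c c', Q k c -> a < c' <= c -> Q k c') ->
  (forall k, (k <= n)%nat -> exists c, a < c /\ Q k c) ->
  exists c, a < c /\ forall k, (k <= n)%nat -> Q k c.
Proof.
  intros Hmon; induction n as [|n IH]; intros H.
  - destruct (H 0%nat) as (c & Hc & HQ); [lia|]; exists c; split; [exact Hc|].
    intros k Hk; replace k with 0%nat by lia; exact HQ.
  - destruct IH as (c & Hc & HQ); [intros; apply H; lia|].
    destruct (H (S n)) as (c' & Hc' & HQ'); [lia|].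
    assert (Hm : a < Rmin c c') by (apply Rmin_glb_lt; assumption).
    pose proof (Rmin_l c c'); pose proof (Rmin_r c c').
    exists (Rmin c c'); split; [exact Hm|].
    intros k Hk; destruct (Nat.eq_dec k (S n)) as [->|].
    + apply Hmon with c'; [assumption|lra].
    + apply Hmon with c; [apply HQ; lia|lra].
Qed.

(** A curve selection lemma. The least residual is carried as coordinate [n], so that it becomes
    monotone in [t] like the coordinates of the point. *)
Lemma residual_curve n lo hi f fs : pvars_in (fun k => (k < n)%nat) f ->
  (forall eps, 0 < eps -> exists x, inZ n lo hi x /\ fs < peval x f < fs + eps) ->
  exists (w : R -> nat -> R) (sg : nat -> R) c, fs < c /\
    (forall t, fs < t < c -> inZ n lo hi (w t) /\ peval (w t) f = t /\
       residual n lo hi f (w t) (w t n) /\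
       forall x r, inZ n lo hi x -> peval x f = t -> residual n lo hi f x r -> w t n <= r) /\
    (forall k, (k <= n)%nat -> (sg k = 1 \/ sg k = -1) /\
       (forall t u, fs < t -> t <= u -> u < c -> sg k * w t k <= sg k * w u k) /\
       (forall t, fs < t < c -> continuous_at (fun t => w t k) t)).
Proof.
  intros Hf Hacc.
  (* [K] bounds all partial derivatives on the box, so it is a valid residual everywhere: the cut
     [v n <= K] makes the slices compact without emptying them. *)
  destruct (grad_bounds n lo hi f Hf) as (K & HK & Hgrad).
  set (A := slice n lo hi f K).
  assert (HAc : forall t, compact_set (S n) (A t)) by (intros; apply slice_compact, Hf).
  assert (HAne : forall x, inZ n lo hi x -> exists v, A (peval x f) v).
  { intros x Hx; set (v := fun i => if Nat.eqb i n then K else x i).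
    assert (Hvx : forall k, (k < n)%nat -> x k = v k).
    { intros k Hk; unfold v; destruct (Nat.eqb_spec k n); [lia|reflexivity]. }
    exists v; repeat split.
    - rewrite <- Hvx by assumption; apply Hx; assumption.
    - rewrite <- Hvx by assumption; apply Hx; assumption.
    - symmetry; apply (peval_ext n); assumption.
    - unfold v; rewrite Nat.eqb_refl; exact HK.
    - intros _; rewrite <- (grad_ext n f x v k Hf Hvx).
      unfold v; rewrite Nat.eqb_refl; destruct (Hgrad k H x x Hx Hx) as [Hb _].
      unfold Rabs in Hb; destruct (Rcase_abs (grad f x k)); lra.
    - intros _; rewrite <- (grad_ext n f x v k Hf Hvx).
      unfold v; rewrite Nat.eqb_refl; destruct (Hgrad k H x x Hx Hx) as [Hb _].
      unfold Rabs in Hb; destruct (Rcase_abs (grad f x k)); lra.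
    - unfold v; rewrite Nat.eqb_refl; lra. }
  assert (HAext : forall t v w, A t v -> (forall k, (k < S n)%nat -> v k = w k) -> A t w).
  { intros t v w; apply compact_set_ext, HAc. }
  (* The attained levels form a definable set; since attained values accumulate at [fs] from above,
     all levels just above [fs] are attained. *)
  assert (Hb : exists b, fs < b /\ forall t, fs < t < b -> exists v, A t v).
  { destruct (definable_germ (fun t => exists v, A t v) fs 1) as (eps & Heps & H).
    - apply (definable_ex_vec (S n)).
      + intros v w e Hv HA; exact (HAext _ _ _ HA Hv).
      + apply definable_family_comp, definable_slice.
    - exists (fs + eps); split; [lra|]; destruct H as [H|H].
      + intros t Ht; replace t with (fs + 1 * (t - fs)) by ring; apply H; lra.
      + exfalso; destruct (Hacc eps Heps) as (x & Hx & Hfx).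
        apply (H (peval x f - fs)); [lra|].
        replace (fs + 1 * (peval x f - fs)) with (peval x f) by ring; auto. }
  destruct Hb as (b & Hb & HAb).
  assert (Hw : forall t, exists v, fs < t < b -> lexmin n n (A t) v).
  { intros t; destruct (classic (fs < t < b)) as [Ht|Ht].
    - destruct (lexmin_nonempty n n (A t) (HAc t) (le_n n) (HAb t Ht)) as [v Hv]; eauto.
    - exists (fun _ => 0); tauto. }
  destruct (choice _ Hw) as [w Hlex].
  destruct (uniform_germ n fs (fun k c => c <= b /\ exists s, (s = 1 \/ s = -1) /\
     (forall t u, fs < t -> t <= u -> u < c -> s * w t k <= s * w u k) /\
     (forall t, fs < t < c -> continuous_at (fun t => w t k) t))) as (c & Hc & HQ).
  - intros k c c' (H1 & s & Hs & H2 & H3) Hc'; split; [lra|]; exists s; split; [exact Hs|].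
    split; [intros t u ? ? ?; apply H2|intros t ?; apply H3]; lra.
  - intros k Hk.
    set (G := fun t y => exists v, lexmin n n (A t) v /\ v k = y).
    assert (HG : definable (fun e => G (e 0%nat) (e 1%nat))).
    { apply (definable_ex_vec (S n) (fun v e => lexmin n n (A (e 0%nat)) v /\ v k = e 1%nat)).
      - intros v u e Hv [H1 H2]; split.
        + revert Hv; apply compact_set_ext; [apply lexmin_compact; auto|exact H1].
        + rewrite <- Hv by lia; exact H2.
      - apply definable_and; [|definability].
        apply (definable_family_comp (fun t => lexmin n n (A t)) (fun i => i)).
        apply definable_lexmin; auto; apply definable_slice. }
    assert (HGw : forall t, fs < t < b -> forall y, G t y <-> y = w t k).
    { intros t Ht y; split.
      - intros (v & Hv & <-); destruct (lexmin_unique n n (A t) v (w t) Hv (Hlex t Ht)) as [E1 E2].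
        destruct (Nat.eq_dec k n) as [->|]; [exact E1|apply E2; lia].
      - intros ->; exists (w t); auto. }
    destruct (definable_monotone_germ G (fun t => w t k) fs b HG Hb HGw)
      as (c1 & Hc1 & s & Hs & Hmon).
    assert (HGw1 : forall t, fs < t < c1 -> forall y, G t y <-> y = w t k).
    { intros t Ht; apply HGw; lra. }
    destruct (definable_continuous_germ G (fun t => w t k) fs c1 s HG (proj1 Hc1) HGw1 Hs Hmon)
      as (c2 & Hc2 & Hcont).
    exists c2; split; [lra|]; split; [lra|]; exists s; split; [exact Hs|]; split; [|exact Hcont].
    intros t u ? ? ?; apply Hmon; lra.
  - destruct (choice (fun k s => (k <= n)%nat -> (s = 1 \/ s = -1) /\
     (forall t u, fs < t -> t <= u -> u < c -> s * w t k <= s * w u k) /\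
     (forall t, fs < t < c -> continuous_at (fun t => w t k) t))) as [sg Hsg].
    { intros k; destruct (le_dec k n) as [Hk|Hk]; [|exists 0; lia].
      destruct (HQ k Hk) as (_ & s & Hs); exists s; auto. }
    exists w, sg, c; split; [exact Hc|]; split; [|exact Hsg].
    intros t Ht; destruct (HQ 0%nat) as [Hcb _]; [lia|].
    assert (Hl : lexmin n n (A t) (w t)) by (apply Hlex; lra).
    destruct (lexmin_sub n n (A t) _ Hl) as (H1 & H2 & H3 & H4).
    repeat (split; [assumption|]); intros x r Hx Hfx Hr.
    (* A residual above the cut [K] exceeds [w t n] anyway. *)
    destruct (Rle_lt_dec r K) as [HrK|HrK]; [|lra].
    set (v := fun i => if Nat.eqb i n then r else x i).
    assert (Hvx : forall k, (k < n)%nat -> x k = v k).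
    { intros k Hk; unfold v; destruct (Nat.eqb_spec k n); [lia|reflexivity]. }
    assert (Hvn : v n = r) by (unfold v; rewrite Nat.eqb_refl; reflexivity).
    rewrite <- Hvn; apply (lexmin_min n n (A t)); [exact Hl|].
    split; [intros k Hk; rewrite <- Hvx by exact Hk; apply Hx, Hk|].
    split; [rewrite <- Hfx; symmetry; apply (peval_ext n); assumption|].
    rewrite Hvn; split; [|exact HrK].
    apply (residual_ext n lo hi f x); assumption.
Qed.

Lemma continuous_at_rsum n (F : nat -> R -> R) (s : nat -> R) t :
  (forall k, (k < n)%nat -> (s k = 1 \/ s k = -1) /\ continuous_at (F k) t) ->
  continuous_at (fun u => rsum n (fun k => s k * F k u)) t.
Proof.
  induction n as [|n IH]; intros H eps Heps; simpl.
  - exists 1; split; [lra|]; intros; lra.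
  - destruct (IH (fun k Hk => H k ltac:(lia)) (eps / 2)) as (d1 & Hd1 & H1); [lra|].
    destruct (H n) as [Hs Hn]; [lia|].
    destruct (Hn (eps / 2)) as (d2 & Hd2 & H2); [lra|].
    pose proof (Rmin_l d1 d2); pose proof (Rmin_r d1 d2).
    exists (Rmin d1 d2); split; [apply Rmin_glb_lt; lra|]; intros u Hu1 Hu2.
    specialize (H1 u ltac:(lra) ltac:(lra)); specialize (H2 u ltac:(lra) ltac:(lra)).
    destruct Hs as [-> | ->]; lra.
Qed.

(* Infinitesimally along the curve the bound is Taylor's formula, the quadratic
   term being absorbed by continuity; [locally_nondecreasing] integrates it. *)
Lemma curve_length_bound (ell r : R -> R) (C a c rho : R) : 0 <= C ->
  (forall t u, a < t -> t <= u -> u < c -> ell t <= ell u) ->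
  (forall t, a < t < c -> continuous_at ell t) ->
  (forall t u, a < t -> t <= u -> u < c ->
     u - t <= (ell u - ell t) * (r u + C * (ell u - ell t))) ->
  forall t u, a < t -> t <= u -> u < c -> (forall v, a < v <= u -> r v <= rho) ->
    u - t <= rho * (ell u - ell t).
Proof.
  intros HC Hmon Hcont Htay t u Hat Htu Huc Hrho.
  assert (Hsmall : forall eta x, 0 < eta -> a < x < c -> exists d, 0 < d /\
     forall y, a < y < c -> - d < y - x -> y - x < d -> C * Rabs (ell y - ell x) <= eta).
  { intros eta x Heta Hx; destruct (Hcont x Hx (eta / (C + 1))) as (d & Hd & H).
    - apply Rdiv_lt_0_compat; lra.
    - exists d; split; [exact Hd|]; intros y Hy H1 H2; destruct (H y H1 H2) as [H3 H4].
      assert (H5 : Rabs (ell y - ell x) <= eta / (C + 1)) by (apply Rlt_le, Rabs_def1; lra).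
      apply (Rmult_le_compat_l C) in H5; [|lra]; eapply Rle_trans; [exact H5|].
      assert (eta / (C + 1) * (C + 1) = eta) by (field; lra).
      assert (0 < eta / (C + 1)) by (apply Rdiv_lt_0_compat; lra).
      lra. }
  assert (Hstep : forall eta x y, 0 < eta -> a < x -> x <= y -> y <= u ->
     C * Rabs (ell y - ell x) <= eta ->
     (rho + eta) * ell x - x <= (rho + eta) * ell y - y).
  { intros eta x y Heta Hx Hxy Hy Hs.
    pose proof (Hmon x y Hx Hxy ltac:(lra)) as Hm.
    pose proof (Htay x y Hx Hxy ltac:(lra)) as Ht.
    pose proof (Hrho y ltac:(lra)).
    rewrite Rabs_right in Hs by lra.
    assert ((ell y - ell x) * (r y + C * (ell y - ell x)) <= (ell y - ell x) * (rho + eta)).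
    { apply Rmult_le_compat_l; lra. }
    lra. }
  (* [eta] absorbs the quadratic term between close points. A last short step from [v] reaches [u],
     which lies outside the open interval (a, u) of [locally_nondecreasing]. *)
  assert (Heta : forall eta, 0 < eta -> u - t <= (rho + eta) * (ell u - ell t)).
  { intros eta Heta.
    destruct (Rle_lt_or_eq_dec t u Htu) as [Hlt|<-]; [|lra].
    destruct (Hsmall eta u Heta ltac:(lra)) as (d & Hd & Hu).
    set (v := Rmax t (u - d / 2)).
    assert (Hv : t <= v < u /\ u - v < d).
    { unfold v; pose proof (Rmax_l t (u - d / 2)); pose proof (Rmax_r t (u - d / 2)).
      split; [split|]; try lra; apply Rmax_lub_lt; lra. }
    assert (H1 : (rho + eta) * ell v - v <= (rho + eta) * ell u - u).
    { apply Hstep; try lra; rewrite Rabs_minus_sym; apply Hu; lra. }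
    assert (H2 : (rho + eta) * ell t - t <= (rho + eta) * ell v - v).
    { apply (locally_nondecreasing (fun x => (rho + eta) * ell x - x) a u); try lra.
      - intros x Hx; destruct (Hsmall eta x Heta ltac:(lra)) as (d' & Hd' & Hx').
        exists (Rmin d' (u - x)); split; [apply Rmin_glb_lt; lra|]; intros k Hk.
        pose proof (Rmin_l d' (u - x)); pose proof (Rmin_r d' (u - x)).
        apply Hstep; try lra; apply Hx'; lra.
      - intros x Hx; destruct (Hsmall eta x Heta ltac:(lra)) as (d' & Hd' & Hx').
        exists (Rmin d' (x - a)); split; [apply Rmin_glb_lt; lra|]; intros k Hk.
        pose proof (Rmin_l d' (x - a)); pose proof (Rmin_r d' (x - a)).
        apply Hstep; try lra; rewrite Rabs_minus_sym; apply Hx'; lra. }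
    lra. }
  (* Letting [eta] tend to 0: a positive gap is refuted by an [eta] that contributes at most half of
     it. *)
  apply Rnot_lt_le; intros Hlt.
  pose proof (Hmon t u Hat Htu Huc) as Hm.
  set (gap := u - t - rho * (ell u - ell t)).
  assert (Hgap : 0 < gap) by (unfold gap; lra).
  specialize (Heta (gap / (2 * (ell u - ell t + 1))) ltac:(apply Rdiv_lt_0_compat; lra)).
  assert (gap / (2 * (ell u - ell t + 1)) * (ell u - ell t + 1) = gap / 2) by (field; lra).
  assert (0 < gap / (2 * (ell u - ell t + 1))) by (apply Rdiv_lt_0_compat; lra).
  unfold gap in *; lra.
Qed.

(** The lower bound on [ell] replaces the usual normalisation of the desingularising function at the
    critical value. *)
Lemma kurdyka_lojasiewicz_box n lo hi f fs : pvars_in (fun k => (k < n)%nat) f ->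
  (forall eps, 0 < eps -> exists x, inZ n lo hi x /\ fs < peval x f < fs + eps) ->
  exists (ell : R -> R) c M, fs < c /\
    (forall t, fs < t < c -> M <= ell t) /\
    (forall t u, fs < t -> t <= u -> u < c -> ell t <= ell u) /\
    (forall x r t, inZ n lo hi x -> residual n lo hi f x r ->
       fs < t -> t <= peval x f -> peval x f < c ->
       peval x f - t <= r * (ell (peval x f) - ell t)).
Proof.
  intros Hf Hacc.
  destruct (residual_curve n lo hi f fs Hf Hacc) as (w & sg & c & Hc & Hw & Hsg).
  destruct (poly_bounds n lo hi f Hf) as (C & HC & Hpoly).
  set (ell := fun t => rsum n (fun k => sg k * w t k)).
  assert (Hmon : forall t u, fs < t -> t <= u -> u < c -> ell t <= ell u).
  { intros t u Ht Htu Hu; apply rsum_le; intros k Hk; apply (Hsg k); auto; lia. }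
  assert (Hcont : forall t, fs < t < c -> continuous_at ell t).
  { intros t Ht; apply (continuous_at_rsum n (fun k t => w t k)); intros k Hk.
    destruct (Hsg k ltac:(lia)) as (H1 & _ & H3); auto. }
  (* Since every coordinate is monotone, the 1-norm distance of two points of the curve is the
     length between them. *)
  assert (Hdist : forall t u, fs < t -> t <= u -> u < c -> dist1 n (w t) (w u) = ell u - ell t).
  { intros t u Ht Htu Hu; unfold dist1, ell.
    replace (rsum n (fun k => sg k * w u k) - rsum n (fun k => sg k * w t k))
      with (rsum n (fun k => sg k * w u k) + -1 * rsum n (fun k => sg k * w t k)) by ring.
    rewrite <- rsum_scal, <- rsum_plus; apply rsum_ext; intros k Hk.
    destruct (Hsg k ltac:(lia)) as (H1 & H2 & _); specialize (H2 t u Ht Htu Hu).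
    destruct H1 as [E|E]; rewrite E in *;
      [rewrite Rabs_left1 by lra|rewrite Rabs_right by lra]; ring. }
  assert (Htay : forall t u, fs < t -> t <= u -> u < c ->
     u - t <= (ell u - ell t) * (w u n + C * (ell u - ell t))).
  { intros t u Ht Htu Hu.
    destruct (Hw t ltac:(lra)) as (Zt & Ft & _ & _); destruct (Hw u ltac:(lra)) as (Zu & Fu & Ru & _).
    destruct (Hpoly (w u) (w t) Zu Zt) as (_ & _ & H).
    pose proof (residual_dirderiv n lo hi f _ _ _ Zu Zt Ru) as H'.
    rewrite Hdist, Ft, Fu in * by assumption.
    simpl in H; unfold Rabs in H; destruct (Rcase_abs _) in H; lra. }
  destruct (Hsg n (le_n n)) as (Hs & Hrmon & _).
  assert (Hr0 : forall t, fs < t < c -> 0 <= w t n).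
  { intros t Ht; destruct (Hw t Ht) as (_ & _ & [H _] & _); exact H. }
  assert (Hmin : forall x r, inZ n lo hi x -> residual n lo hi f x r -> fs < peval x f < c ->
     w (peval x f) n <= r).
  { intros x r Hx Hr Hfx; destruct (Hw _ Hfx) as (_ & _ & _ & H); apply (H x); auto. }
  destruct Hs as [Es|Es].
  (* Nondecreasing residual: its value at [u] bounds it on all of (fs, u]. The length is bounded
     below because the curve stays in the box. *)
  - set (M := rsum n (fun k => - (Rabs (lo k) + Rabs (hi k)))).
    exists ell, c, M; split; [exact Hc|]; split; [|split; [exact Hmon|]].
    + intros t Ht; apply rsum_le; intros k Hk.
      destruct (Hw t Ht) as (Zt & _); specialize (Zt k Hk).
      destruct (Hsg k ltac:(lia)) as ([E|E] & _); rewrite E;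
      unfold Rabs; destruct (Rcase_abs (lo k)), (Rcase_abs (hi k)); lra.
    + intros x r t Hx Hr Ht Htx Hxc; set (u := peval x f) in *.
      apply Rle_trans with (w u n * (ell u - ell t)).
      * apply (curve_length_bound ell (fun t => w t n) C fs c); auto; try lra.
        intros v Hv; specialize (Hrmon v u); rewrite Es in Hrmon; lra.
      * apply Rmult_le_compat_r; [specialize (Hmon t u); lra|]; apply Hmin; auto; fold u; lra.
  (* Nonincreasing residual: on (fs, m] it is at least [w m n], so a linear [ell] suffices once this
     number is positive. *)
  - set (m := (fs + c) / 2).
    assert (Hm : fs < m < c) by (unfold m; lra).
    assert (Hdec : forall t u, fs < t -> t <= u -> u < c -> w u n <= w t n).
    { intros t u Ht Htu Hu; specialize (Hrmon t u Ht Htu Hu); rewrite Es in Hrmon; lra. }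
    (* Otherwise the residual would vanish beyond [m], and the length bound with constant 0 would
       make two distinct levels equal. *)
    assert (Hpos : 0 < w m n).
    { destruct (Rle_lt_or_eq_dec 0 (w m n) (Hr0 m Hm)) as [H|H]; [exact H|exfalso].
      set (u := (m + c) / 2); set (t := (m + u) / 2).
      assert (u - t <= w m n * (ell u - ell t)).
      { apply (curve_length_bound ell (fun t => w t n) C m c); unfold t, u in *; auto; try lra.
        - intros; apply Hmon; lra.
        - intros; apply Hcont; lra.
        - intros; apply Htay; lra.
        - intros v Hv; apply Hdec; lra. }
      rewrite <- H in H0; unfold t, u in *; lra. }
    exists (fun t => t * / w m n), m, (fs * / w m n).
    assert (Hinv : 0 < / w m n) by (apply Rinv_0_lt_compat; exact Hpos).
    split; [lra|]; split; [|split].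
    + intros t Ht; apply Rmult_le_compat_r; lra.
    + intros t u Ht Htu Hu; apply Rmult_le_compat_r; lra.
    + intros x r t Hx Hr Ht Htx Hxc; set (u := peval x f) in *.
      assert (w m n <= r).
      { apply Rle_trans with (w u n); [apply Hdec; lra|apply Hmin; auto; fold u; lra]. }
      replace (r * (u * / w m n - t * / w m n)) with (r * / w m n * (u - t)) by ring.
      assert (1 <= r * / w m n).
      { apply (Rmult_le_reg_r (w m n)); [exact Hpos|]; rewrite Rmult_assoc, Rinv_l; lra. }
      nra.
Qed.

(** * Descent and convergence *)

Lemma rsum_change_one n F G k : (k < n)%nat ->
  (forall j, (j < n)%nat -> j <> k -> F j = G j) -> rsum n F - rsum n G = F k - G k.
Proof.
  intros Hk H.
  replace (F k - G k) with ((F k - G k) * 1) by ring.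
  rewrite <- (rsum_delta n (F k - G k) k (fun _ => 1) Hk).
  replace (rsum n F) with
    (rsum n (fun j => G j + (if Nat.eqb k j then F k - G k else 0) * 1)).
  - rewrite rsum_plus; ring.
  - apply rsum_ext; intros j Hj; destruct (Nat.eqb_spec k j) as [<-|Hne]; [ring|].
    rewrite H by auto; ring.
Qed.

Lemma bsum_ext n blk i F G : (forall k, (k < n)%nat -> blk k = i -> F k = G k) ->
  bsum n blk i F = bsum n blk i G.
Proof.
  intros H; apply rsum_ext; intros k Hk; destruct (Nat.eqb_spec (blk k) i); auto.
Qed.

Lemma bsum_le n blk i F G : (forall k, (k < n)%nat -> blk k = i -> F k <= G k) ->
  bsum n blk i F <= bsum n blk i G.
Proof.
  intros H; apply rsum_le; intros k Hk; destruct (Nat.eqb_spec (blk k) i); auto; lra.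
Qed.

Lemma bsum_scal n blk i c F : bsum n blk i (fun k => c * F k) = c * bsum n blk i F.
Proof.
  unfold bsum; rewrite <- rsum_scal; apply rsum_ext; intros k _.
  destruct (Nat.eqb (blk k) i); ring.
Qed.

Lemma bsum_sqr_nonneg n blk i F : 0 <= bsum n blk i (fun k => F k ^ 2).
Proof.
  apply rsum_nonneg; intros k _; destruct (Nat.eqb (blk k) i); [apply pow2_ge_0|lra].
Qed.

(** Cauchy-Schwarz, to pass between the Euclidean norm of the algorithm and the 1-norm of the
    estimates. *)
Lemma dist1_sqr_le n x y : dist1 n x y ^ 2 <= INR n * rsum n (fun k => (x k - y k) ^ 2).
Proof.
  unfold dist1; induction n as [|n IH]; [simpl; lra|].
  rewrite S_INR; cbn [rsum].
  set (S := rsum n (fun k => Rabs (x k - y k))) in *.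
  set (Q := rsum n (fun k => (x k - y k) ^ 2)) in *.
  rewrite <- (pow2_abs (x n - y n)); set (d := Rabs (x n - y n)).
  assert (HQ : 0 <= Q) by (apply rsum_nonneg; intros; apply pow2_ge_0).
  pose proof (pos_INR n).
  destruct (Req_dec (INR n) 0) as [E|E].
  - rewrite E in *; assert (S = 0) as -> by nra; nra.
  - assert (0 <= INR n * (Q + INR n * d ^ 2 - 2 * S * d)).
    { pose proof (pow2_ge_0 (S - INR n * d)); nra. }
    assert (0 <= Q + INR n * d ^ 2 - 2 * S * d).
    { apply (Rmult_le_reg_l (INR n)); [lra|]; rewrite Rmult_0_r; assumption. }
    nra.
Qed.

(** * Projected gradient steps with backtracking *)

Lemma is_proj_blk_coord n blk lo hi i x u k : is_proj_blk n blk lo hi i x u ->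
  (k < n)%nat -> blk k = i -> (lo k < u k -> u k <= x k) /\ (u k < hi k -> x k <= u k).
Proof.
  intros [Hu Hmin] Hk Hi.
  (* Changing one coordinate of [u] within its bounds gives a competitor, so the projection is
     optimal coordinate by coordinate. *)
  assert (key : forall y, lo k <= y <= hi k -> (x k - u k) ^ 2 <= (x k - y) ^ 2).
  { intros y Hy; set (v := fun j => if Nat.eqb j k then y else u j).
    assert (Hv : in_box_blk n blk lo hi i v).
    { intros j Hj Hji; unfold v; destruct (Nat.eqb_spec j k) as [->|]; auto. }
    specialize (Hmin v Hv); unfold bsum in Hmin.
    assert (E := rsum_change_one n (fun k => if Nat.eqb (blk k) i then (x k - u k) ^ 2 else 0)
                  (fun k => if Nat.eqb (blk k) i then (x k - v k) ^ 2 else 0) k Hk).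
    cbv beta in E; rewrite Hi, Nat.eqb_refl in E.
    replace y with (v k) by (unfold v; rewrite Nat.eqb_refl; reflexivity).
    specialize (E ltac:(intros j Hj Hne; apply Nat.eqb_neq in Hne; unfold v; rewrite Hne; reflexivity)).
    lra. }
  destruct (Hu k Hk Hi) as [Hlo Hhi].
  split; intros Hb; apply Rnot_lt_le; intros Hlt.
  (* If [x k < u k], lowering [u k] to [x k], or to the lower bound if it is met first, would come
     strictly closer. *)
  - specialize (key (Rmax (lo k) (x k))).
    pose proof (Rmax_l (lo k) (x k)); pose proof (Rmax_r (lo k) (x k)).
    assert (Rmax (lo k) (x k) < u k) by (apply Rmax_lub_lt; lra).
    specialize (key ltac:(lra)); nra.
  - specialize (key (Rmin (hi k) (x k))).
    pose proof (Rmin_l (hi k) (x k)); pose proof (Rmin_r (hi k) (x k)).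
    assert (u k < Rmin (hi k) (x k)) by (apply Rmin_glb_lt; lra).
    specialize (key ltac:(lra)); nra.
Qed.

(** A rejection in [block_update] quantifies over projections, so it carries information only once a
    projection exists. *)
Lemma is_proj_blk_exists n blk lo hi i x : (forall k, (k < n)%nat -> lo k <= hi k) ->
  exists u, is_proj_blk n blk lo hi i x u.
Proof.
  intros Hbox; exists (fun k => Rmax (lo k) (Rmin (hi k) (x k))).
  assert (Hc : forall k, (k < n)%nat -> forall y, lo k <= y <= hi k ->
     lo k <= Rmax (lo k) (Rmin (hi k) (x k)) <= hi k /\
     (x k - Rmax (lo k) (Rmin (hi k) (x k))) ^ 2 <= (x k - y) ^ 2).
  { intros k Hk y Hy; specialize (Hbox k Hk).
    assert (sqr : forall s t, 0 <= s <= t \/ t <= s <= 0 -> s ^ 2 <= t ^ 2) by (intros; nra).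
    unfold Rmin, Rmax; destruct (Rle_dec (hi k) (x k)); destruct (Rle_dec (lo k) _);
      split; try lra; apply sqr; lra. }
  split.
  - intros k Hk _; apply (Hc k Hk (lo k)); specialize (Hbox k Hk); lra.
  - intros y Hy; apply bsum_le; intros k Hk Hi; apply (Hc k Hk), Hy; assumption.
Qed.

Lemma inZ_repl n blk lo hi i w u : inZ n lo hi w -> in_box_blk n blk lo hi i u ->
  inZ n lo hi (repl blk i w u).
Proof.
  intros Hw Hu k Hk; unfold repl; destruct (Nat.eqb_spec (blk k) i); [apply Hu|apply Hw]; auto.
Qed.

(** [Cm] bounds every accepted [c] uniformly over the box: the last value is [c0] or [beta] times a
    rejected one, and rejected values are below [c1]. The projection then bounds the gradient at [w]
    by the step, with the active bounds read at [u]. *)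
Lemma block_update_spec n blk lo hi f alpha beta c0 i :
  pvars_in (fun k => (k < n)%nat) f -> (forall k, (k < n)%nat -> lo k <= hi k) ->
  0 < alpha -> 1 < beta -> 0 < c0 ->
  exists Cm, 0 <= Cm /\ forall w u, inZ n lo hi w ->
    block_update n blk lo hi f alpha beta c0 i w u ->
    in_box_blk n blk lo hi i u /\
    peval (repl blk i w u) f + alpha / 2 * bsum n blk i (fun k => (u k - w k) ^ 2) <= peval w f /\
    forall k, (k < n)%nat -> blk k = i ->
      (lo k < u k -> grad f w k <= Cm * Rabs (u k - w k)) /\
      (u k < hi k -> - (Cm * Rabs (u k - w k)) <= grad f w k).
Proof.
  intros Hf Hbox Ha Hb Hc0.
  destruct (poly_bounds n lo hi f Hf) as (M & HM & Hpoly).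
  (* Half of [c1] covers the Taylor remainder, at most [M * INR n] times the squared step, and the
     required margin [alpha / 2]. *)
  set (c1 := 2 * M * INR n + alpha).
  assert (Hc1 : 0 < c1) by (unfold c1; pose proof (pos_INR n); nra).
  assert (Hacc : forall w c u, inZ n lo hi w -> in_box_blk n blk lo hi i u -> c1 <= c ->
            accept n blk f alpha i w c u).
  { intros w c u Hw Hu Hc; unfold accept.
    destruct (Hpoly w (repl blk i w u) Hw (inZ_repl _ _ _ _ _ _ _ Hw Hu)) as (_ & _ & H).
    replace (dirderiv n f w (fun k => repl blk i w u k - w k))
      with (bsum n blk i (fun k => grad f w k * (u k - w k))) in H.
    2: { apply rsum_ext; intros k _; unfold repl; destruct (Nat.eqb (blk k) i); ring. }
    pose proof (dist1_sqr_le n (repl blk i w u) w) as HD.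
    replace (rsum n (fun k => (repl blk i w u k - w k) ^ 2))
      with (bsum n blk i (fun k => (u k - w k) ^ 2)) in HD.
    2: { apply rsum_ext; intros k _; unfold repl; destruct (Nat.eqb (blk k) i); ring. }
    pose proof (bsum_sqr_nonneg n blk i (fun k => u k - w k)) as HB.
    set (B := bsum n blk i (fun k => (u k - w k) ^ 2)) in *.
    apply (Rmult_le_compat_l M) in HD; [|exact HM].
    assert (c1 * B <= c * B) by (apply Rmult_le_compat_r; assumption).
    unfold c1 in *; unfold Rabs in H; destruct (Rcase_abs _) in H; lra. }
  exists (c0 + beta * c1); split; [nra|].
  intros w u Hw (t & Hrej & Hproj & Hok).
  assert (Hpow : 0 < beta ^ t) by (apply pow_lt; lra).
  set (c := c0 * beta ^ t) in *.
  assert (Hcpos : 0 < c) by (apply Rmult_lt_0_compat; assumption).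
  assert (Hc : c <= c0 + beta * c1).
  { destruct t as [|t]; [unfold c; simpl; nra|].
    destruct (is_proj_blk_exists n blk lo hi i (gstep f w (c0 * beta ^ t)) Hbox) as [u' Hu'].
    specialize (Hrej t ltac:(lia) u' Hu').
    assert (c0 * beta ^ t < c1).
    { apply Rnot_le_lt; intros Hle; apply Hrej, Hacc; auto; apply Hu'. }
    unfold c; simpl; replace (c0 * (beta * beta ^ t)) with (beta * (c0 * beta ^ t)) by ring.
    assert (beta * (c0 * beta ^ t) <= beta * c1) by (apply Rmult_le_compat_l; lra). lra. }
  assert (Hg : forall k, (k < n)%nat -> blk k = i ->
     (lo k < u k -> grad f w k <= c * (w k - u k)) /\
     (u k < hi k -> c * (w k - u k) <= grad f w k)).
  { intros k Hk Hi; destruct (is_proj_blk_coord _ _ _ _ _ _ _ k Hproj Hk Hi) as [H1 H2].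
    unfold gstep in *.
    assert (E : c * (w k - / c * grad f w k) = c * w k - grad f w k) by (field; lra).
    split; intros Hbd; [apply H1 in Hbd|apply H2 in Hbd];
      apply (Rmult_le_compat_l c) in Hbd; lra. }
  split; [apply Hproj|split].
  - unfold accept in Hok.
    (* The variational inequality of the projection, tested at [w]; it outweighs the term [c / 2] of
       the acceptance test and leaves a decrease. *)
    assert (bsum n blk i (fun k => grad f w k * (u k - w k))
            <= - c * bsum n blk i (fun k => (u k - w k) ^ 2)).
    { rewrite <- bsum_scal; apply bsum_le; intros k Hk Hi.
      destruct (Hg k Hk Hi) as [H1 H2]; specialize (Hw k Hk).
      destruct (Rtotal_order (u k) (w k)) as [H|[H|H]].
      - assert (c * (w k - u k) <= grad f w k) by (apply H2; lra); nra.
      - rewrite H; lra.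
      - assert (grad f w k <= c * (w k - u k)) by (apply H1; lra); nra. }
    pose proof (bsum_sqr_nonneg n blk i (fun k => u k - w k)) as HB.
    nra.
  - intros k Hk Hi; destruct (Hg k Hk Hi) as [H1 H2].
    pose proof (Rle_abs (u k - w k)); pose proof (Rle_abs (- (u k - w k))) as Hn.
    rewrite Rabs_Ropp in Hn; pose proof (Rabs_pos (u k - w k)).
    assert (c * Rabs (u k - w k) <= (c0 + beta * c1) * Rabs (u k - w k))
      by (apply Rmult_le_compat_r; assumption).
    assert (c * - (u k - w k) <= c * Rabs (u k - w k)) by (apply Rmult_le_compat_l; lra).
    assert (c * (u k - w k) <= c * Rabs (u k - w k)) by (apply Rmult_le_compat_l; lra).
    split; intros Hbd; [apply H1 in Hbd|apply H2 in Hbd]; lra.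
Qed.

Lemma sweep_descent n P blk lo hi f alpha beta c0 :
  pvars_in (fun k => (k < n)%nat) f -> (forall k, (k < n)%nat -> (blk k < P)%nat) ->
  (forall k, (k < n)%nat -> lo k <= hi k) -> 1 < beta ->
  (forall i, (i < P)%nat -> 0 < alpha i) -> (forall i, (i < P)%nat -> 0 < c0 i) ->
  exists a B, 0 < a /\ 0 <= B /\ forall z z', inZ n lo hi z ->
    sweep n P blk lo hi f alpha beta c0 z z' ->
    inZ n lo hi z' /\
    peval z' f + a * rsum n (fun k => (z' k - z k) ^ 2) <= peval z f /\
    residual n lo hi f z' (B * dist1 n z' z).
Proof.
  intros Hf Hblk Hbox Hbeta Halpha Hc0.
  (* A common positive lower bound of the [alpha i / 2]. [uniform_germ] includes its last index,
     hence [pred P], and the guard covers [P = 0]. *)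
  destruct (uniform_germ (pred P) 0 (fun i c => (i < P)%nat -> c <= alpha i / 2)) as (a & Ha & HaP).
  { intros k c c' H Hc Hk; specialize (H Hk); lra. }
  { intros k _; destruct (lt_dec k P) as [Hk|Hk]; [|exists 1; split; [lra|lia]].
    exists (alpha k / 2); specialize (Halpha k Hk); split; [lra|intros; lra]. }
  destruct (uniform_bound P (fun i Cm => 0 <= Cm /\ forall w u, inZ n lo hi w ->
    block_update n blk lo hi f (alpha i) beta (c0 i) i w u ->
    in_box_blk n blk lo hi i u /\
    peval (repl blk i w u) f + alpha i / 2 * bsum n blk i (fun k => (u k - w k) ^ 2) <= peval w f /\
    forall k, (k < n)%nat -> blk k = i ->
      (lo k < u k -> grad f w k <= Cm * Rabs (u k - w k)) /\
      (u k < hi k -> - (Cm * Rabs (u k - w k)) <= grad f w k))) as (Cm & HCm & Hupd).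
  { intros i C C' [HC H] HCC; split; [lra|]; intros w u Hw Hu.
    destruct (H w u Hw Hu) as (H1 & H2 & H3); split; [exact H1|split; [exact H2|]].
    intros k Hk Hi; destruct (H3 k Hk Hi) as [H4 H5].
    assert (C * Rabs (u k - w k) <= C' * Rabs (u k - w k))
      by (apply Rmult_le_compat_r; [apply Rabs_pos|assumption]).
    split; intros Hbd; [apply H4 in Hbd|apply H5 in Hbd]; lra. }
  { intros i Hi; apply block_update_spec; auto. }
  destruct (grad_bounds n lo hi f Hf) as (M & HM & Hgrad).
  (* [Cm] accounts for the gradient at the point where the block was updated, [M] for its change
     from there to [z']. *)
  exists a, (Cm + M); split; [exact Ha|split; [lra|]].
  intros z z' Hz Hsw.
  assert (Hz' : inZ n lo hi z').
  (* The estimates for a block assume that its starting point lies in the box, so membership goes by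
     induction over the blocks. *)
  { assert (H : forall i, (i <= P)%nat -> inZ n lo hi (mix blk i z z')).
    { induction i as [|i IH]; intros Hi.
      - intros k Hk; unfold mix; simpl; apply Hz, Hk.
      - destruct (Hsw i ltac:(lia)) as (u & Hu & Hzu).
        destruct (Hupd i ltac:(lia)) as [_ H].
        destruct (H _ _ (IH ltac:(lia)) Hu) as (Hbx & _ & _).
        intros k Hk; specialize (IH ltac:(lia) k Hk); unfold mix in *.
        destruct (Nat.ltb_spec (blk k) (S i)), (Nat.ltb_spec (blk k) i); auto; try lia.
        rewrite Hzu by lia; apply Hbx; lia. }
    intros k Hk; specialize (H P (le_n P) k Hk); unfold mix in H.
    specialize (Hblk k Hk); destruct (Nat.ltb_spec (blk k) P); [exact H|lia]. }
  assert (Hmix : forall i, inZ n lo hi (mix blk i z z')).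
  { intros i k Hk; unfold mix; destruct (Nat.ltb (blk k) i); auto. }
  split; [exact Hz'|split].
  - assert (Hdesc : forall i, (i <= P)%nat -> peval (mix blk i z z') f +
       a * rsum n (fun k => if Nat.ltb (blk k) i then (z' k - z k) ^ 2 else 0) <= peval z f).
    { induction i as [|i IH]; intros Hi.
      - rewrite (rsum_ext _ _ (fun _ => 0)), rsum_const by reflexivity.
        rewrite (peval_ext n f (mix blk 0 z z') z Hf); [lra|reflexivity].
      - specialize (IH ltac:(lia)).
        destruct (Hsw i ltac:(lia)) as (u & Hu & Hzu).
        destruct (Hupd i ltac:(lia)) as [_ H].
        destruct (H _ _ (Hmix i) Hu) as (_ & H2 & _).
        rewrite (peval_ext n f (repl blk i (mix blk i z z') u) (mix blk (S i) z z') Hf) in H2.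
        2: { intros k Hk; unfold repl, mix.
             destruct (Nat.eqb_spec (blk k) i), (Nat.ltb_spec (blk k) (S i)),
               (Nat.ltb_spec (blk k) i); try lia; auto; symmetry; apply Hzu; auto. }
        rewrite (bsum_ext _ _ _ _ (fun k => (z' k - z k) ^ 2)) in H2.
        2: { intros k Hk Hki; rewrite <- Hzu by auto; unfold mix.
             destruct (Nat.ltb_spec (blk k) i); [lia|reflexivity]. }
        rewrite (rsum_ext _ _ (fun k => (if Nat.ltb (blk k) i then (z' k - z k) ^ 2 else 0)
                            + (if Nat.eqb (blk k) i then (z' k - z k) ^ 2 else 0))).
        2: { intros k Hk; destruct (Nat.ltb_spec (blk k) (S i)), (Nat.ltb_spec (blk k) i),
               (Nat.eqb_spec (blk k) i); try lia; ring. }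
        rewrite rsum_plus.
        pose proof (bsum_sqr_nonneg n blk i (fun k => z' k - z k)) as HB.
        specialize (HaP i ltac:(lia) ltac:(lia)).
        apply (Rmult_le_compat_r _ _ _ HB) in HaP.
        unfold bsum in *; lra. }
    specialize (Hdesc P (le_n P)).
    rewrite (peval_ext n f (mix blk P z z') z' Hf) in Hdesc.
    2: { intros k Hk; unfold mix; specialize (Hblk k Hk).
         destruct (Nat.ltb_spec (blk k) P); [reflexivity|lia]. }
    rewrite (rsum_ext _ _ (fun k => (z' k - z k) ^ 2)) in Hdesc; [exact Hdesc|].
    intros k Hk; specialize (Hblk k Hk); destruct (Nat.ltb_spec (blk k) P); [reflexivity|lia].
  - pose proof (dist1_nonneg n z' z) as HD.
    split; [apply Rmult_le_pos; lra|]; intros k Hk; set (i := blk k).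
    destruct (Hsw i (Hblk k Hk)) as (u & Hu & Hzu).
    destruct (Hupd i (Hblk k Hk)) as [_ H].
    destruct (H _ _ (Hmix i) Hu) as (_ & _ & H3).
    destruct (H3 k Hk eq_refl) as [H4 H5].
    rewrite <- (Hzu k Hk eq_refl) in H4, H5.
    replace (mix blk i z z' k) with (z k) in H4, H5.
    2: { unfold mix, i; rewrite Nat.ltb_irrefl; reflexivity. }
    destruct (Hgrad k Hk (mix blk i z z') z' (Hmix i) Hz') as [_ H6].
    assert (H7 : dist1 n z' (mix blk i z z') <= dist1 n z' z).
    { apply rsum_le; intros j _; unfold mix; destruct (Nat.ltb (blk j) i); [|lra].
      rewrite Rminus_diag, Rabs_R0; apply Rabs_pos. }
    pose proof (dist1_term n z' z k Hk) as H8.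
    apply (Rmult_le_compat_l M) in H7; [|exact HM].
    apply (Rmult_le_compat_l Cm) in H8; [|exact HCm].
    unfold Rabs in H6; destruct (Rcase_abs _) in H6;
      split; intros Hbd; [apply H4 in Hbd|apply H5 in Hbd|apply H4 in Hbd|apply H5 in Hbd]; lra.
Qed.

(** * Finite length and the limit *)

Lemma finite_length_cv n (z : nat -> nat -> R) (V : nat -> R) L m :
  (forall l, (L <= l)%nat -> dist1 n (z (S l)) (z l) <= V l - V (S l)) ->
  (forall l, (L <= l)%nat -> m <= V l) ->
  exists zinf, forall k, (k < n)%nat -> Un_cv (fun l => z l k) (zinf k).
Proof.
  intros HV Hm.
  assert (Hdec : Un_decreasing (fun l => V (L + l)%nat)).
  { intros l; rewrite <- plus_n_Sm.
    pose proof (HV (L + l)%nat ltac:(lia)); pose proof (dist1_nonneg n (z (S (L + l))) (z (L + l)%nat)).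
    lra. }
  destruct (decreasing_cv _ Hdec) as [v Hv].
  { exists (- m); intros x [l ->]; unfold opp_seq; specialize (Hm (L + l)%nat ltac:(lia)); lra. }
  (* The steps telescope, so the Cauchy property of [V] passes to each coordinate. *)
  assert (Hpq : forall k p q, (k < n)%nat -> (L <= p)%nat -> (p <= q)%nat ->
                  Rabs (z q k - z p k) <= V p - V q).
  { intros k p q Hk Hp Hq; induction Hq as [|q Hq IH].
    - rewrite Rminus_diag, Rabs_R0; lra.
    - replace (z (S q) k - z p k) with ((z (S q) k - z q k) + (z q k - z p k)) by ring.
      pose proof (Rabs_triang (z (S q) k - z q k) (z q k - z p k)).
      pose proof (dist1_term n (z (S q)) (z q) k Hk); specialize (HV q ltac:(lia)); lra. }
  assert (H : forall k, exists x, (k < n)%nat -> Un_cv (fun l => z l k) x).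
  { intros k; destruct (lt_dec k n) as [Hk|Hk]; [|exists 0; lia].
    destruct (R_complete (fun l => z l k)) as [x Hx]; [|exists x; auto].
    intros eps Heps; destruct (CV_Cauchy _ (exist _ v Hv) eps Heps) as [N HN].
    exists (L + N)%nat.
    assert (Hle : forall p q, (L + N <= p)%nat -> (p <= q)%nat -> Rabs (z q k - z p k) < eps).
    { intros p q Hp Hq; specialize (HN (q - L)%nat (p - L)%nat ltac:(lia) ltac:(lia)).
      unfold Rdist in HN.
      replace (L + (q - L))%nat with q in HN by lia; replace (L + (p - L))%nat with p in HN by lia.
      specialize (Hpq k p q Hk ltac:(lia) Hq); apply Rabs_def2 in HN; lra. }
    intros p q Hp Hq; unfold Rdist; destruct (Nat.le_ge_cases p q).
    - rewrite Rabs_minus_sym; apply Hle; lia.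
    - apply Hle; lia. }
  destruct (choice _ H) as [zinf Hz]; exists zinf; exact Hz.
Qed.

Lemma descent_finite_length n lo hi f (z : nat -> nat -> R) a B :
  pvars_in (fun k => (k < n)%nat) f -> 0 < a -> 0 <= B ->
  (forall l, inZ n lo hi (z l)) ->
  (forall l, peval (z (S l)) f + a * rsum n (fun k => (z (S l) k - z l k) ^ 2) <= peval (z l) f) ->
  (forall l, residual n lo hi f (z (S l)) (B * dist1 n (z (S l)) (z l))) ->
  exists zinf, forall k, (k < n)%nat -> Un_cv (fun l => z l k) (zinf k).
Proof.
  intros Hf Ha HB HZ Hdesc Hres.
  set (F := fun l => peval (z l) f); set (d := fun l => dist1 n (z (S l)) (z l)).
  set (kappa := INR n / a).
  assert (Hkappa : 0 <= kappa) by (apply Rmult_le_pos; [apply pos_INR|apply Rlt_le, Rinv_0_lt_compat, Ha]).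
  assert (Hd0 : forall l, 0 <= d l) by (intros; apply dist1_nonneg).
  assert (Hd : forall l, d l ^ 2 <= kappa * (F l - F (S l))).
  { intros l; eapply Rle_trans; [apply dist1_sqr_le|].
    replace (INR n) with (kappa * a) by (unfold kappa; field; lra).
    rewrite Rmult_assoc; apply Rmult_le_compat_l; [exact Hkappa|].
    specialize (Hdesc l); unfold F; lra. }
  assert (Hdec : Un_decreasing F).
  { intros l; specialize (Hdesc l); unfold F.
    assert (0 <= rsum n (fun k => (z (S l) k - z l k) ^ 2))
      by (apply rsum_nonneg; intros; apply pow2_ge_0).
    nra. }
  destruct (poly_bounds n lo hi f Hf) as (M & _ & HM).
  destruct (decreasing_cv F Hdec) as [fs Hfs].
  { exists M; intros x [l ->]; unfold opp_seq.
    destruct (HM (z l) (z l) (HZ l) (HZ l)) as (H & _); unfold F.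
    unfold Rabs in H; destruct (Rcase_abs _) in H; lra. }
  assert (HFfs : forall l, fs <= F l) by (intros; apply decreasing_ineq; assumption).
  assert (Hanti : forall p q, (p <= q)%nat -> F q <= F p).
  { intros p q Hpq; induction Hpq as [|q _ IH]; [lra|]; specialize (Hdec q); lra. }
  destruct (classic (exists L, F L <= fs)) as [[L HL]|Hno].
  - apply (finite_length_cv n z (fun _ => 0) L 0); [|intros; lra].
    intros l Hl; pose proof (Hanti L l Hl); pose proof (HFfs (S l)); pose proof (HFfs l).
    specialize (Hd l); specialize (Hd0 l).
    replace (F l - F (S l)) with 0 in Hd.
    + fold (d l); nra.
    + pose proof (Hdec l); lra.
  - assert (Hgt : forall l, fs < F l).
    { intros l; apply Rnot_le_lt; intros H; apply Hno; eauto. }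
    destruct (kurdyka_lojasiewicz_box n lo hi f fs Hf) as (ell & c & m & Hc & Hlow & Hmon & HKL).
    { intros eps Heps; destruct (Hfs eps Heps) as [N HN].
      exists (z N); split; [apply HZ|].
      specialize (HN N (le_n N)); unfold Rdist in HN; apply Rabs_def2 in HN.
      specialize (Hgt N); unfold F in *; lra. }
    destruct (Hfs (c - fs)) as [L HL]; [lra|].
    assert (HFc : forall l, (L <= l)%nat -> F l < c).
    { intros l Hl; specialize (HL l Hl); unfold Rdist in HL; apply Rabs_def2 in HL; lra. }
    set (b := kappa * B); assert (Hb : 0 <= b) by (apply Rmult_le_pos; assumption).
    (* The estimate [2 * d (S l) <= d l + b * D] says that [d (S l)] is at most the decrease of this
       potential. It refers to the previous step, hence the start at [S L]. *)
    apply (finite_length_cv n z (fun l => d (pred l) + b * ell (F l)) (S L) (b * m)).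
    + intros [|l] Hl; [lia|]; simpl pred.
      specialize (HKL (z (S l)) _ (F (S (S l))) (HZ _) (Hres l) (Hgt _) (Hdec _)
                      (HFc (S l) ltac:(lia))).
      fold (F (S l)) (d l) (d (S l)) in *.
      pose proof (Hd (S l)) as H1; apply (Rmult_le_compat_l kappa) in HKL; [|exact Hkappa].
      set (D := ell (F (S l)) - ell (F (S (S l)))) in *.
      assert (HD : 0 <= D).
      { unfold D; assert (ell (F (S (S l))) <= ell (F (S l))); [|lra].
        apply Hmon; [apply Hgt|apply Hdec|apply HFc; lia]. }
      assert (H2 : d (S l) ^ 2 <= d l * (b * D)) by (unfold b; lra).
      (* AM-GM: [2 d_(l+1) <= 2 sqrt (d_l * b D) <= d_l + b D] *)
      assert (H3 : 2 * d (S l) <= d l + b * D).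
      { assert (0 <= b * D) by (apply Rmult_le_pos; assumption).
        pose proof (Hd0 l); pose proof (Hd0 (S l)).
        set (x := d l) in *; set (y := b * D) in *; set (w := d (S l)) in *.
        clearbody x y w; apply Rnot_lt_le; intros Hlt.
        assert (0 < (2 * w - (x + y)) * (2 * w + (x + y))) by (apply Rmult_lt_0_compat; lra).
        pose proof (pow2_ge_0 (x - y)); lra. }
      unfold D in H3; lra.
    + intros [|l] Hl; [lia|].
      pose proof (Hd0 (pred (S l))).
      assert (m <= ell (F (S l))) by (apply Hlow; split; [apply Hgt|apply HFc; lia]).
      apply (Rmult_le_compat_l b) in H0; lra.
Qed.

(** Along a convergent sequence the steps, and with them the residuals, tend to 0. The residual
    condition is closed, and residual 0 at the limit gives the normal cone inequality. *)
Lemma descent_critical_limit n lo hi f (z : nat -> nat -> R) zinf B :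
  pvars_in (fun k => (k < n)%nat) f ->
  (forall l, inZ n lo hi (z l)) ->
  (forall l, residual n lo hi f (z (S l)) (B * dist1 n (z (S l)) (z l))) ->
  (forall k, (k < n)%nat -> Un_cv (fun l => z l k) (zinf k)) ->
  inZ n lo hi zinf /\ in_normal_cone n lo hi zinf (fun k => - grad f zinf k).
Proof.
  intros Hf HZ Hres Hcv.
  assert (Hshift : forall k, (k < n)%nat -> Un_cv (fun l => z (S l) k) (zinf k)).
  { intros k Hk; apply (Un_cv_subseq (fun l => z l k)); auto. }
  assert (Hinf : inZ n lo hi zinf).
  { intros k Hk; split.
    - apply (cv_ge_const (fun l => z l k)); [auto|]; intros l; apply HZ, Hk.
    - apply (cv_le_const (fun l => z l k)); [auto|]; intros l; apply HZ, Hk. }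
  split; [exact Hinf|].
  assert (H0 : residual n lo hi f zinf 0).
  { apply (residual_closed n lo hi f (fun l => z (S l)) zinf
             (fun l => B * dist1 n (z (S l)) (z l))); auto.
    replace 0 with (B * rsum n (fun k => Rabs (zinf k - zinf k))).
    - apply (CV_mult (fun _ => B)); [apply Un_cv_const|].
      apply (rsum_cv n (fun l k => Rabs (z (S l) k - z l k))); intros k Hk.
      apply (cv_cvabs (fun l => z (S l) k - z l k)).
      apply (CV_minus (fun l => z (S l) k)); auto.
    - rewrite (rsum_ext _ _ (fun _ => 0)), rsum_const; [ring|].
      intros k _; rewrite Rminus_diag, Rabs_R0; reflexivity. }
  intros y Hy; pose proof (residual_dirderiv n lo hi f zinf y 0 Hinf Hy H0) as H.
  rewrite (rsum_ext _ _ (fun k => -1 * (grad f zinf k * (y k - zinf k)))) by (intros; ring).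
  rewrite rsum_scal; unfold dirderiv in H; lra.
Qed.

Lemma pvars_in_psum A n F : (forall k, (k < n)%nat -> pvars_in A (F k)) -> pvars_in A (psum n F).
Proof.
  induction n as [|n IH]; intros H; simpl; [exact I|].
  split; [apply IH; intros|]; apply H; lia.
Qed.

Theorem mainTheorem5
  (nz P : nat) (blk : nat -> nat) (lo hi : nat -> R)
  (J : nat -> mpoly) (m : nat) (Qc : nat -> mpoly)
  (q : nat -> nat) (g : nat -> nat -> mpoly) (p : nat)
  (T : nat -> nat -> nat -> R) (Sset : (nat -> R) -> Prop) (s : nat -> R)
  (muc : nat -> R) (mug : nat -> nat -> R) (rho : R)
  (alpha : nat -> R) (beta : R) (c0 : nat -> R)
  (z : nat -> nat -> R)
  (HP : (1 <= P)%nat) (Hnz : (2 <= nz)%nat)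
  (Hblk : forall k, (k < nz)%nat -> (blk k < P)%nat)
  (Hblk_ne : forall i, (i < P)%nat -> exists k, (k < nz)%nat /\ blk k = i)
  (Hbox : forall k, (k < nz)%nat -> lo k <= hi k)
  (HJvars : forall i, (i < P)%nat -> pvars_in (fun k => (k < nz)%nat /\ blk k = i) (J i))
  (HJdeg : forall i, (i < P)%nat -> ~ poly_deg_le (J i) 1)
  (HQvars : forall k, (k < m)%nat -> pvars_in (fun k' => (k' < nz)%nat) (Qc k))
  (Hgvars : forall i j, (i < P)%nat -> (j < q i)%nat ->
              pvars_in (fun k => (k < nz)%nat /\ blk k = i) (g i j))
  (Hs : Sset s) (Hrho : 0 < rho)
  (Halpha : forall i, (i < P)%nat -> 0 < alpha i) (Hbeta : 1 < beta)
  (Hc0 : forall i, (i < P)%nat -> 0 < c0 i)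
  (Hz0 : inZ nz lo hi (z 0%nat))
  (Hsweep : forall l, sweep nz P blk lo hi (L_poly P J m Qc q g p T s muc mug rho)
                            alpha beta c0 (z l) (z (S l))) :
  exists zinf : nat -> R,
    inZ nz lo hi zinf /\
    (forall k, (k < nz)%nat -> Un_cv (fun l => z l k) (zinf k)) /\
    in_normal_cone nz lo hi zinf
      (fun k => - grad (L_poly P J m Qc q g p T s muc mug rho) zinf k).
Proof.
  set (f := L_poly P J m Qc q g p T s muc mug rho) in *.
  assert (Hblkvars : forall i r, pvars_in (fun k => (k < nz)%nat /\ blk k = i) r ->
             pvars_in (fun k => (k < nz)%nat) r).
  { intros i r; apply pvars_in_weaken; tauto. }
  assert (Hf : pvars_in (fun k => (k < nz)%nat) f).
  { unfold f, L_poly; simpl; repeat split.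
    - apply pvars_in_psum; intros i Hi; apply (Hblkvars i), HJvars, Hi.
    - apply pvars_in_psum; intros k Hk; specialize (HQvars k Hk); simpl; tauto.
    - apply pvars_in_psum; intros i Hi; apply pvars_in_psum; intros j Hj.
      assert (pvars_in (fun k => (k < nz)%nat) (g i j)) by (apply (Hblkvars i), Hgvars; assumption).
      unfold Gg; simpl; tauto. }
  destruct (sweep_descent nz P blk lo hi f alpha beta c0) as (a & B & Ha & HB & Hstep); auto.
  assert (HZ : forall l, inZ nz lo hi (z l)).
  { induction l as [|l IH]; [exact Hz0|apply (Hstep (z l)); auto]. }
  destruct (descent_finite_length nz lo hi f z a B) as [zinf Hcv]; auto;
    try (intros l; apply Hstep; auto).
  destruct (descent_critical_limit nz lo hi f z zinf B) as [Hin Hcrit]; auto.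
  { intros l; apply Hstep; auto. }
  exists zinf; auto.
Qed.
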